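(* Let $a,b\ge 2$ be integers, $n=ab$, and let $\nu\vdash b$. Let $U_{\nu,a}$ be the $(1^b)$-component of the restriction $F_\nu^a\downarrow_{S_b\times S_{n-b}}$ of the generalized Foulkes module (as defined in the context). Then, as $S_b\times S_{n-b}$-modules, $$U_{\nu,a}\cong\bigoplus_{\mu,\lambda\vdash b} c_{\mu,\lambda}^{\nu}\, S^{\mu}\times F_{\lambda}^{a-1}.$$ In particular, for $a=2$, $$U_{\nu,2}\cong\bigoplus_{\mu,\lambda\vdash b} c_{\mu,\lambda}^{\nu}\, S^{\mu}\times S^{\lambda}.$$
   Context: All modules are over $\mathbb{C}$. For a partition $\nu\vdash b$, $S^\nu$ is the Specht module of $S_b$ ($S^{(b)}$ trivial, $S^{(1^b)}$ sign). For integers $a\ge1$, $b\ge 2$, $S_a\wr S_b\le S_{ab}$ is the stabilizer of a partition of $\{1,\dots,ab\}$ into $b$ blocks of size $a$; its base group $S_a^b$ has quotient $S_b$, and $\mathrm{Inf}_{S_b}^{S_a\wr S_b}S^\nu$ is $S^\nu$ viewed as an $S_a\wr S_b$-module via this quotient. The generalized Foulkes module is the $S_{ab}$-module $F_\nu^a=\mathrm{Inf}_{S_b}^{S_a\wr S_b}S^\nu\uparrow^{S_{ab}}$ (induced module); in particular $F_\nu^1=S^\nu$. $c_{\mu,\lambda}^\nu$ is the Kronecker coefficient: the multiplicity of $S^\nu$ in the $S_b$-module $S^\mu\otimes S^\lambda$ ($\mu,\lambda,\nu\vdash b$). For an $S_k$-module $M$ and an $S_{n-k}$-module $N$, $M\times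 N$ is the (outer tensor product) $S_k\times S_{n-k}$-module. A coefficient $c$ in front of a module means the direct sum of $c$ copies. Concrete model of $F_\nu^a$ ($a,b\ge2$, $n=ab$): let $H=H_b^a$ be the set of ordered partitions $X=(X_1,\dots,X_b)$ of $\{1,\dots,n\}$ into $b$ sets of size $a$; $S_n$ acts on $H$ by permuting letters. A $\nu$-tableau $t$ is a bijective filling of the diagram of $\nu$ by $1,\dots,b$; $t_X$ is the diagram of $\nu$ filled by replacing $l$ in $t$ with $X_l$; the ''tabloid'' $\{t_X\}$ is its row-equivalence class (entries may be permuted within rows). Let $V$ be the $\mathbb{C}$-vector space with formal basis all such ''tabloids'' of shape $\nu$, and let $e_{t_X}=\sum_{\pi\in C_t}\mathrm{sgn}(\pi)\{(\pi t)_X\}\in V$, where $C_t\le S_b$ is the column stabilizer of $t$ (i.e. replace each letter $l$ by $X_l$ in the usual polytabloid $e_t$). $S_n$ acts by $g\{t_X\}=\{t_{gX}\}$, so $g e_{t_X}=e_{t_{gX}}$. The span of $\{e_{t_X}\mid X\in H\}$ (for any fixed $t$) is isomorphic to $F_\nu^a$ and is taken as $F_\nu^a$. Components: for $0<k<n$, let $\Omega_k$ be the set of partitions of $k$ with at most $b$ parts, all of size at most $a$. For $\lambda\in\Omega_k$ let $P_\lambda$ be the set of $X\in H$ such that the nonzero numbers $|X_i\cap\{1,\dots,k\}|$, arranged in decreasing order, form $\lambda$, and let $V_{\nu,a}^\lambda$ be the $S_k\times S_{n-k}$-module generated by (equivalently, spanned by) $\{e_{t_X}\mid X\in P_\lambda\}$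 for any $\nu$-tableau $t$, where $S_k=\mathrm{Sym}\{1,\dots,k\}$ and $S_{n-k}=\mathrm{Sym}\{k+1,\dots,n\}$. One has $F_\nu^a\downarrow_{S_k\times S_{n-k}}=\bigoplus_{\lambda\in\Omega_k}V_{\nu,a}^\lambda$. For $k=b$, $U_{\nu,a}=V_{\nu,a}^{(1^b)}$ (spanned by the $e_{t_X}$ with every $X_i$ containing exactly one element of $\{1,\dots,b\}$). *)

(* Defs.v *)
From HB Require Import structures.
From mathcomp Require Import all_boot all_order all_fingroup all_algebra.
From mathcomp Require Import all_character.
From mathcomp Require Import boolp reals complex.

Set Implicit Arguments.
Unset Strict Implicit.
Unset Printing Implicit Defensive.

Import GroupScope GRing.Theory.
Local Open Scope ring_scope.

(* Conventions. MathComp multiplies permutations from left to right and lets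
   representations act on row vectors from the right; both conventions are
   opposite to the usual ones, so a right module here is a left module in the
   usual notation. The letters 1, ..., n are the elements 0, ..., n-1 of 'I_n. *)

Definition is_part (b : nat) (s : seq nat) : bool :=
  [&& sorted geq s, 0%N \notin s & sumn s == b].

(* Partitions of b as a finite type; the length and the parts of a partition
   of b are at most b, see [intpart_complete]. *)
Record intpart (b : nat) : Type := IntPart {
  intpart_val : {bseq b of 'I_b.+1};
  _ : is_part b [seq val i | i <- intpart_val] }.

HB.instance Definition _ b := [isSub for @intpart_val b].
HB.instance Definition _ b := [Finite of intpart b by <:].

Definition parts b (nu : intpart b) : seq nat := [seq val i | i <- intpart_val nu].

Lemma sumn_ge_mem (s : seq nat) x : x \in s -> (x <= sumn s)%N.
Proof.
elim: s => //= y s IHs; rewrite inE => /orP[/eqP-> | /IHs sx].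
  exact: leq_addr.
exact: leq_trans sx (leq_addl _ _).
Qed.

Lemma sumn_ge_size (s : seq nat) : 0%N \notin s -> (size s <= sumn s)%N.
Proof.
elim: s => //= y s IHs; rewrite inE negb_or eq_sym -lt0n => /andP[y0 /IHs ss].
by rewrite -add1n leq_add.
Qed.

Lemma intpart_complete b s : is_part b s -> exists nu : intpart b, parts nu = s.
Proof.
move=> ps; have /and3P[_ s0 /eqP sb] := ps.
have szs : (size [seq @inord b i | i <- s] <= b)%N.
  by rewrite size_map -sb sumn_ge_size.
have vals : [seq val i | i <- Bseq szs] = s.
  rewrite /= -map_comp -[RHS]map_id; apply/eq_in_map => i si /=.
  by rewrite inordK // ltnS -sb sumn_ge_mem.
have pv : is_part b [seq val i | i <- Bseq szs] by rewrite vals.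
by exists (IntPart pv).
Qed.

Section Tableaux.

Variables (b : nat) (nu : intpart b).

(* The cells (row, column) of the diagram of nu. *)
Definition cell : Type :=
  {c : 'I_b * 'I_b | (c.2 < nth 0 (parts nu) c.1)%N}.
HB.instance Definition _ := Finite.on cell.

Definition row_of (c : cell) : 'I_b := (sval c).1.
Definition col_of (c : cell) : 'I_b := (sval c).2.

(* The row-equivalence class of a filling f of the diagram. *)
Definition tabloid (D : finType) (f : {ffun cell -> D}) :
    {set {ffun cell -> D}} :=
  [set [ffun c => f (q c)] |
     q : {perm cell} & [forall c, row_of (q c) == row_of c]].

Variable L : finType.

Definition is_tableau (t : {ffun cell -> L}) : bool :=
  injectiveb t && [forall l, l \in codom t].

Definition col_stab (t : {ffun cell -> L}) : {set {perm L}} :=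
  [set p : {perm L} | [forall c, forall d,
     (t d == p (t c)) ==> (col_of d == col_of c)]].

End Tableaux.

Lemma card_cell b (nu : intpart b) : #|{: cell nu}| = b.
Proof.
case/and3P: (valP nu) => _ n0 /eqP nb; rewrite -/(parts nu) in n0 nb.
have sz : (size (parts nu) <= b)%N by rewrite -[leqRHS]nb sumn_ge_size.
have le_b i : (nth 0 (parts nu) i <= b)%N.
  case: (ltnP i (size (parts nu))) => [lti | gei]; last by rewrite nth_default.
  by rewrite -[leqRHS]nb sumn_ge_mem // mem_nth.
rewrite card_sig -sum1_card.
rewrite (eq_bigl (fun c : 'I_b * 'I_b =>
    true && (c.2 < nth 0 (parts nu) c.1)%N)) //.
rewrite -(pair_big_dep xpredT
  (fun i j : 'I_b => (j < nth 0 (parts nu) i)%N) (fun _ _ => 1%N)) /=.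
transitivity (\sum_(i < b) nth 0 (parts nu) i)%N.
  apply: eq_bigr => i _.
  rewrite -(big_ord_widen _ (fun=> 1%N) (le_b i)).
  by rewrite sum1_card card_ord.
rewrite -[RHS]nb sumnE (big_nth 0%N) (big_mkord xpredT).
rewrite (big_ord_widen _ (fun i => nth 0%N (parts nu) i) sz).
rewrite [RHS]big_mkcond /=; apply: eq_bigr => i _.
by case: ltnP => // ge_i; rewrite nth_default.
Qed.

Lemma tableau_exists b (nu : intpart b) :
  exists t : {ffun cell nu -> 'I_b}, is_tableau t.
Proof.
pose f (c : cell nu) : 'I_b := cast_ord (card_cell nu) (enum_rank c).
pose h (i : 'I_b) : cell nu := enum_val (cast_ord (esym (card_cell nu)) i).
exists [ffun c => f c]; apply/andP; split.
  apply/injectiveP => c d; rewrite !ffunE => /cast_ord_inj.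
  exact: enum_rank_inj.
apply/forallP => l; apply/codomP; exists (h l).
by rewrite ffunE /f /h enum_valK cast_ordKV.
Qed.

Section PermutationModules.

Variables (F : fieldType) (gT : finGroupType).

Section OfAction.

Variables (B : finType) (to : {action gT &-> B}).

Definition bvec (x : B) : 'rV[F]_#|B| := delta_mx 0 (enum_rank x).

Definition act_mx (g : gT) : 'M[F]_#|B| :=
  \matrix_(i, j) (to (enum_val i) g == enum_val j)%:R.

Lemma bvec_act x g : bvec x *m act_mx g = bvec (to x g).
Proof.
rewrite -rowE; apply/rowP => j; rewrite !mxE enum_rankK eqxx /=.
by congr (_%:R); rewrite -(inj_eq enum_rank_inj) enum_valK eq_sym.
Qed.

Lemma act_mx_repr : mx_repr [set: gT] act_mx.
Proof.
have rowK i g : row i (act_mx g) = bvec (to (enum_val i) g).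
  by rewrite rowE -bvec_act /bvec enum_valK.
split=> [|g h _ _]; apply/row_matrixP => i.
  by rewrite rowK act1 /bvec enum_valK rowE mulmx1.
by rewrite rowK row_mul rowK bvec_act actM.
Qed.

Definition act_repr : mx_representation F [set: gT] #|B| :=
  MxRepresentation act_mx_repr.

End OfAction.

Section FfunAction.

Variables (I D : finType) (to : {action gT &-> D}).

Definition ffunact (f : {ffun I -> D}) (g : gT) : {ffun I -> D} :=
  [ffun i => to (f i) g].

Lemma ffunact_is_action1 : ffunact^~ 1%g =1 id.
Proof. by move=> f; apply/ffunP => i; rewrite ffunE act1. Qed.

Lemma ffunact_is_actionM f : act_morph ffunact f.
Proof. by move=> g h; apply/ffunP => i; rewrite !ffunE actM. Qed.

Definition ffun_action : {action gT &-> {ffun I -> D}} :=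
  TotalAction ffunact_is_action1 ffunact_is_actionM.

End FfunAction.

(* The span of a family of vectors that is permuted by the group. *)
Lemma span_module (G : {group gT}) n (rG : mx_representation F G n)
    (I : finType) (P : pred I) (e : I -> 'rV[F]_n) (s : gT -> I -> I) :
    (forall g i, g \in G -> P i -> P (s g i)) ->
    (forall g i, g \in G -> e i *m rG g = e (s g i)) ->
  mxmodule rG (\sum_(i | P i) <<e i>>)%MS.
Proof.
move=> Ps es; apply/mxmoduleP => g Gg; rewrite sumsmxMr; apply/sumsmx_subP.
move=> i Pi; have Psi := Ps g i Gg Pi.
apply: submx_trans (sumsmx_sup (s g i) Psi (submx_refl _)).
by rewrite (eqmxMr _ (genmxE _)) es // genmxE.
Qed.

End PermutationModules.

Section Restriction.

Variables (F : fieldType) (aT rT : finGroupType).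
Variable f : {morphism [set: aT] >-> rT}.

Lemma res_group : f @*^-1 [set: rT] == [set: aT].
Proof. by rewrite morphpreT. Qed.

Definition res_repr n (rG : mx_representation F [set: rT] n) :
    mx_representation F [set: aT] n :=
  eqg_repr (morphpre_repr f rG) res_group.

End Restriction.

Section Products.

Variable F : fieldType.

Definition tensor_repr (gT : finGroupType)
    (V W : representation F [set: gT]) : representation F [set: gT] :=
  Representation (prod_repr V W).

Definition outer_repr (gT hT : finGroupType) (V : representation F [set: gT])
    (W : representation F [set: hT]) : representation F [set: gT * hT] :=
  Representation
    (prod_repr (res_repr [morphism of fst] V) (res_repr [morphism of snd] W)).

End Products.

Section Polytabloids.

Variables (F : fieldType) (b : nat) (nu : intpart b).

Section Ambient.

Variables (gT : finGroupType) (D : finType) (to : {action gT &-> D}).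

(* The permutation module on sets of fillings; it contains the permutation
   module on the row-equivalence classes of fillings. *)
Definition tabloid_repr :
    mx_representation F [set: gT] #|{: {set {ffun cell nu -> D}}}| :=
  act_repr F (ffun_action (cell nu) to)^*.

Lemma tabloid_act (f : {ffun cell nu -> D}) (g : gT) :
  ((ffun_action (cell nu) to)^* (tabloid f) g)%act = tabloid (ffunact to f g).
Proof.
apply/setP => x; apply/imsetP/imsetP => [[y /imsetP[q qr ->] ->] | [q qr ->]].
  by exists q => //; apply/ffunP => c; rewrite !ffunE.
exists [ffun c => f (q c)]; first by apply/imsetP; exists q.
by apply/ffunP => c; rewrite !ffunE.
Qed.

End Ambient.

(* The polytabloid e_t with every letter l replaced by x l. *)
Definition polytabloid (L D : finType) (t : {ffun cell nu -> L})
    (x : L -> D) : 'rV[F]_#|{: {set {ffun cell nu -> D}}}| :=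
  \sum_(p in col_stab t)
     (-1) ^+ odd_perm p *: bvec F (tabloid [ffun c => x (p (t c))]).

Lemma polytabloid_act (gT : finGroupType) (L D : finType)
    (to : {action gT &-> D}) (t : {ffun cell nu -> L}) (x y : L -> D) g :
    (forall l, y l = to (x l) g) ->
  polytabloid t x *m tabloid_repr to g = polytabloid t y.
Proof.
move=> yE; rewrite mulmx_suml; apply: eq_bigr => p _.
rewrite -scalemxAl bvec_act tabloid_act; congr (_ *: bvec _ (tabloid _)).
by apply/ffunP => c; rewrite !ffunE yE.
Qed.

End Polytabloids.

Section Specht.

Variables (F : fieldType) (b : nat) (nu : intpart b) (L : finType).

Definition specht_space : 'M[F]_#|{: {set {ffun cell nu -> L}}}| :=
  (\sum_(t : {ffun cell nu -> L} | is_tableau t) <<polytabloid F t id>>)%MS.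

Lemma specht_module : mxmodule (tabloid_repr F nu 'P%act) specht_space.
Proof.
apply: (@span_module F {perm L} [set: {perm L}]%G _
  (tabloid_repr F nu 'P%act) {ffun cell nu -> L} (@is_tableau b nu L)
  (fun t => polytabloid F t id) (fun g t => [ffun c => g (t c)])) => g t _.
  case/andP=> /injectiveP t_inj /forallP t_surj; apply/andP; split.
    by apply/injectiveP => c d; rewrite !ffunE => /perm_inj /t_inj.
  apply/forallP => l; case/codomP: (t_surj ((g^-1)%g l)) => c lc.
  by apply/codomP; exists c; rewrite ffunE -lc permKV.
rewrite (@polytabloid_act _ _ _ _ _ _ _ t id (fun l => g l)) //.
rewrite /polytabloid [RHS](reindex_inj (conjg_inj g)) /=.
apply: eq_big => [p | p _].
  rewrite !inE; apply: eq_forallb => c; apply: eq_forallb => d.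
  by rewrite !ffunE permJ (inj_eq perm_inj).
rewrite odd_permJ; congr (_ *: bvec _ (tabloid _)).
by apply/ffunP => c; rewrite !ffunE permJ.
Qed.

Definition specht : representation F [set: {perm L}] :=
  Representation (submod_repr specht_module).

End Specht.

Definition is_opart (a b n : nat) (X : {ffun 'I_b -> {set 'I_n}}) : bool :=
  [&& [forall i, #|X i| == a],
      [forall i, forall j, (i != j) ==> [disjoint X i & X j]]
    & \bigcup_i X i == setT].

Definition move_blocks (b n : nat) (g : 'S_n) (X : {ffun 'I_b -> {set 'I_n}}) :
    {ffun 'I_b -> {set 'I_n}} :=
  [ffun i => g @: X i].

Lemma is_opart_move a b n (g : 'S_n) (X : {ffun 'I_b -> {set 'I_n}}) :
  is_opart a X -> is_opart a (move_blocks g X).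
Proof.
case/and3P => /forallP Xa /forallP Xd /eqP Xc; apply/and3P; split.
- by apply/forallP => i; rewrite ffunE card_imset //; apply: perm_inj.
- apply/forallP => i; apply/forallP => j; apply/implyP => ij; rewrite !ffunE.
  rewrite imset_disjoint; last exact: perm_inj.
  by have /forallP/(_ j)/implyP := Xd i; apply.
apply/eqP/setP => x; rewrite inE; apply/bigcupP.
have: (g^-1)%g x \in \bigcup_i X i by rewrite Xc.
case/bigcupP => i _ xi; exists i => //; rewrite ffunE.
by rewrite -(permKV g x) imset_f.
Qed.

Section Foulkes.

Variables (F : fieldType) (b : nat) (nu : intpart b).
Variables (t : {ffun cell nu -> 'I_b}) (a n : nat).

Definition foulkes_ambient := tabloid_repr F nu ('P%act^* : {action 'S_n &-> _}).

Lemma polytabloid_move g (X : {ffun 'I_b -> {set 'I_n}}) :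
  polytabloid F t X *m foulkes_ambient g = polytabloid F t (move_blocks g X).
Proof. by apply: polytabloid_act => l; rewrite ffunE. Qed.

Definition foulkes_space : 'M[F]_#|{: {set {ffun cell nu -> {set 'I_n}}}}| :=
  (\sum_(X : {ffun 'I_b -> {set 'I_n}} | is_opart a X)
     <<polytabloid F t X>>)%MS.

Lemma foulkes_module : mxmodule foulkes_ambient foulkes_space.
Proof.
apply: (@span_module F 'S_n [set: 'S_n]%G _ foulkes_ambient _ (@is_opart a b n)
  (fun X => polytabloid F t X) (@move_blocks b n)) => g X _.
  exact: is_opart_move.
exact: polytabloid_move.
Qed.

(* This is F_nu^a when n = a * b, and zero otherwise. *)
Definition foulkes : representation F [set: 'S_n] :=
  Representation (submod_repr foulkes_module).

End Foulkes.

Section YoungSubgroup.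

Variables k m : nat.
Implicit Types g h : 'S_k * 'S_m.

Definition young_fun g (i : 'I_(k + m)) : 'I_(k + m) :=
  match split i with
  | inl j => lshift m (g.1 j)
  | inr j => rshift k (g.2 j)
  end.

Lemma young_funM g h i : young_fun (g * h)%g i = young_fun h (young_fun g i).
Proof.
rewrite /young_fun; case: (split_ordP i) => j _.
  by rewrite (unsplitK (inl _)) permM.
by rewrite (unsplitK (inr _)) permM.
Qed.

Lemma young_fun1 i : young_fun 1%g i = i.
Proof. by rewrite /young_fun; case: split_ordP => j ->; rewrite perm1. Qed.

Lemma young_fun_inj g : injective (young_fun g).
Proof.
apply: (can_inj (g := young_fun (g^-1)%g)) => i.
by rewrite -young_funM mulgV young_fun1.
Qed.

Definition young_perm g : 'S_(k + m) := perm (@young_fun_inj g).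

End YoungSubgroup.

(* The isomorphism of S_k x S_(n-k) with Sym{1..k} x Sym{k+1..n} <= S_n. *)
Definition young_embed k n (hk : (k <= n)%N) (g : 'S_k * 'S_(n - k)) : 'S_n :=
  cast_perm (subnKC hk) (young_perm g).

Lemma young_embedM k n (hk : (k <= n)%N) :
  {in [set: 'S_k * 'S_(n - k)] &,
    {morph young_embed hk : g h / (g * h)%g >-> (g * h)%g}}.
Proof.
move=> g h _ _; apply/permP => i; rewrite permM /young_embed !cast_permE.
by rewrite !permE young_funM cast_ordK.
Qed.

Canonical young_morphism k n (hk : (k <= n)%N) := Morphism (young_embedM hk).

Lemma young_embedE k n (hk : (k <= n)%N) (g : 'S_k * 'S_(n - k)) :
  (forall (i : 'I_k), young_embed hk g (widen_ord hk i) = g.1 i :> nat) /\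
  (forall (i : 'I_n) (j : 'I_(n - k)), i = (k + j)%N :> nat ->
     young_embed hk g i = (k + g.2 j)%N :> nat).
Proof.
split=> [i | i j ij]; rewrite /young_embed cast_permE /= permE /young_fun.
  suff -> : cast_ord (esym (subnKC hk)) (widen_ord hk i) = lshift (n - k) i.
    by rewrite (unsplitK (inl _)).
  exact: val_inj.
suff -> : cast_ord (esym (subnKC hk)) i = rshift k j.
  by rewrite (unsplitK (inr _)).
exact: val_inj.
Qed.

Lemma young_embed_lt k n (hk : (k <= n)%N) (g : 'S_k * 'S_(n - k)) (i : 'I_n) :
  (young_embed hk g i < k)%N = (i < k)%N.
Proof.
have [gl gr] := young_embedE hk g; case: (ltnP i k) => [ik | ki].
  by rewrite (_ : i = widen_ord hk (Ordinal ik)) ?gl ?ltn_ord //; apply: val_inj.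
have jk : (i - k < n - k)%N by rewrite ltn_sub2r // (leq_ltn_trans ki).
rewrite (gr i (Ordinal jk)) /= ?subnKC //.
by rewrite ltnNge leq_addr.
Qed.

(* X lies in P_lambda iff block_type k X is lambda. *)
Definition block_type b n (k : nat) (X : {ffun 'I_b -> {set 'I_n}}) : seq nat :=
  sort geq [seq m <- [seq #|X i :&: [set x : 'I_n | (x < k)%N]| | i : 'I_b]
              | m != 0%N].

Lemma block_type_move b k n (hk : (k <= n)%N) (g : 'S_k * 'S_(n - k))
    (X : {ffun 'I_b -> {set 'I_n}}) :
  block_type k (move_blocks (young_embed hk g) X) = block_type k X.
Proof.
rewrite /block_type; congr (sort _ (filter _ _)); apply: eq_map => i.
rewrite ffunE -[RHS](card_imset _ (@perm_inj _ (young_embed hk g))).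
rewrite imsetI; last by move=> x y _ _; apply: perm_inj.
congr #|pred_of_set (_ :&: _)|; apply/setP => x; rewrite inE.
rewrite -(permKV (young_embed hk g) x) mem_imset; last exact: perm_inj.
by rewrite inE young_embed_lt.
Qed.

Section Components.

Variables (F : fieldType) (b : nat) (nu : intpart b).
Variables (t : {ffun cell nu -> 'I_b}) (a n k : nat) (hk : (k <= n)%N).
Variable lambda : seq nat.

Definition foulkes_ambient_res :=
  res_repr (young_morphism hk) (@foulkes_ambient F b nu n).

Definition component_space : 'M[F]_#|{: {set {ffun cell nu -> {set 'I_n}}}}| :=
  (\sum_(X : {ffun 'I_b -> {set 'I_n}} |
          is_opart a X && (block_type k X == lambda))
     <<polytabloid F t X>>)%MS.

Lemma component_module : mxmodule foulkes_ambient_res component_space.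
Proof.
apply: (@span_module F _ [set: 'S_k * 'S_(n - k)]%G _ foulkes_ambient_res _
  (fun X => is_opart a X && (block_type k X == lambda))
  (fun X => polytabloid F t X) (fun g => move_blocks (young_embed hk g))).
  by move=> g X _ /andP[Xa]; rewrite block_type_move is_opart_move.
by move=> g X _; apply: polytabloid_move.
Qed.

(* The lambda-component of the restriction of F_nu^a to S_k x S_(n-k). *)
Definition component : representation F [set: 'S_k * 'S_(n - k)] :=
  Representation (submod_repr component_module).

End Components.

Lemma block_letters_le a b : (1 < a)%N -> (b <= a * b)%N.
Proof. by move=> a1; rewrite leq_pmull // ltnW. Qed.

Definition foulkesU (F : fieldType) (a b : nat) (ha : (1 < a)%N)
    (nu : intpart b) (t : {ffun cell nu -> 'I_b}) :
    representation F [set: 'S_b * 'S_(a * b - b)] :=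
  component F t a (block_letters_le b ha) (nseq b 1%N).

(* The number of summands similar to the simple module S in a decomposition of
   the semisimple module V into simple modules; at most one isotypic component W
   contributes to the sum. *)
Definition multiplicity (F : decFieldType) (gT : finGroupType)
    (G : {group gT}) (S V : representation F G) : nat :=
  (\sum_(W : DecSocleType V | `[< mx_rsim (socle_repr W) S >]) socle_mult W)%N.

Definition kronecker (F : decFieldType) b (mu la nu : intpart b) : nat :=
  multiplicity (specht F nu 'I_b)
    (tensor_repr (specht F mu 'I_b) (specht F la 'I_b)).

(* Main.v *)
(* Over a field of characteristic zero two representations with the same trace
   function are isomorphic, so the theorem is an identity between traces.

   The module spanned by the polytabloids e_{t_X}, for X in an S_b-invariant
   family P of injective labellings, is cut out by the average over X in P of the
   transports along X of a projector onto the Specht space; hence the trace of g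
   on it is 1/b! times the sum over w in S_b of chi^nu(w) #{X in P | g X = X w}.
   If every block meets {1..b} exactly once, X amounts to a permutation of
   {1..b} and an ordered partition of the other letters, so the count factors as
   #{p | w^p = g_1} times the count for F_lambda^(a-1), and what is left to prove
   is
     sum_(mu, lambda) c_(mu,lambda)^nu chi^mu(g) chi^lambda(w)
       = chi^nu(w) #{p | w^p = g},
   which is the second orthogonality relation applied twice.  That relation rests
   on the Specht modules being irreducible, pairwise non-isomorphic and at least
   as numerous as the conjugacy classes of S_b. *)

Require Import Defs.
From HB Require Import structures.
From mathcomp Require Import all_boot all_order all_fingroup all_algebra.
From mathcomp Require Import all_solvable all_character.
From mathcomp Require Import ring.
From mathcomp Require Import boolp reals complex.

Set Implicit Arguments.
Unset Strict Implicit.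
Unset Printing Implicit Defensive.

Import GroupScope GRing.Theory.
Local Open Scope ring_scope.

(** * Representations with equal traces *)

Section Traces.

Variables (F : numClosedFieldType) (gT : finGroupType) (G : {group gT}).
Local Notation reprG := (mx_representation F G).

Lemma pchar_pgroup : [pchar F]^'.-group G.
Proof. by apply/pgroupP => p _ _; rewrite inE /= Num.Theory.pchar_num. Qed.

Lemma natr_card_neq0 : #|G|%:R != 0 :> F.
Proof. by rewrite Num.Theory.pnatr_eq0 -lt0n cardG_gt0. Qed.

(** Schur's lemma: the kernel and the row space of [M] are submodules, so a nonzero [M] is both
    injective and surjective. *)
Lemma intertwiner_rsim n1 n2 (rS : reprG n1) (rT : reprG n2) M :
    mx_irreducible rS -> mx_irreducible rT -> M != 0 ->
    {in G, forall x, rS x *m M = M *m rT x} -> mx_rsim rS rT.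
Proof.
move=> /mx_irrP[n1_gt0 irrS] /mx_irrP[n2_gt0 irrT] nzM homM.
have kerM : kermx M = 0.
  apply/eqP; apply: contraTT nzM => nzk; rewrite negbK.
  have: row_full (kermx M).
    apply: irrS => //; apply/mxmoduleP => x Gx; apply/sub_kermxP.
    by rewrite -mulmxA homM // mulmxA mulmx_ker mul0mx.
  by rewrite -sub1mx => /sub_kermxP; rewrite mul1mx => ->.
have freeM : row_free M by rewrite -kermx_eq0 kerM.
have: row_full <<M>>%MS.
  apply: irrT; last by rewrite -mxrank_eq0 genmxE mxrank_eq0.
  apply/mxmoduleP => x Gx; rewrite (eqmxMr _ (genmxE _)) genmxE.
  by rewrite -homM ?submxMl.
rewrite /row_full genmxE => /eqP rkM.
by exists M => //; rewrite -rkM; apply/esym/eqP.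
Qed.

(* Averages over the group intertwine, so Schur's lemma applies to them. *)
Lemma averageJ n1 n2 (rS : reprG n1) (rT : reprG n2) (A : 'M_(n1, n2)) :
  let M := \sum_(g in G) rS g *m A *m rT g^-1%g in
  {in G, forall x, rS x *m M = M *m rT x}.
Proof.
move=> M x Gx; rewrite mulmx_sumr mulmx_suml.
rewrite [RHS](reindex_inj (mulgI x)) /=.
apply: eq_big => g; first by rewrite groupMl.
move=> Gg; rewrite invMg !repr_mxM ?groupV // !mulmxA.
by rewrite repr_mxKV.
Qed.

(** The [(i, j)] entry of [rS g *m delta_mx i j *m rT g^-1] is a product of two diagonal entries.
    This turns a sum of products of traces into averages to which Schur's lemma applies. *)
Lemma orthogonality_delta n1 n2 (rS : reprG n1) (rT : reprG n2) :
  \sum_(g in G) \tr (rS g) * \tr (rT g^-1%g) =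
  \sum_i \sum_j (\sum_(g in G) rS g *m delta_mx i j *m rT g^-1%g) i j.
Proof.
transitivity (\sum_(g in G) \sum_i \sum_j rS g i i * rT g^-1%g j j).
  by apply: eq_bigr => g _; rewrite mulr_suml; apply: eq_bigr => i _;
    rewrite mulr_sumr.
rewrite exchange_big; apply: eq_bigr => i _.
rewrite exchange_big; apply: eq_bigr => j _.
rewrite summxE; apply: eq_bigr => g _.
rewrite mxE (bigD1 j) //= big1 => [|k nkj]; last first.
  by rewrite mxE big1 ?mul0r // => l _; rewrite mxE (negPf nkj) andbF mulr0.
by rewrite addr0 mxE (bigD1 i) //= big1 => [|k nki];
  rewrite !mxE ?eqxx ?mulr1 ?addr0 // (negPf nki) mulr0.
Qed.

Lemma orthogonality_not_rsim n1 n2 (rS : reprG n1) (rT : reprG n2) :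
    mx_irreducible rS -> mx_irreducible rT -> ~ mx_rsim rS rT ->
  \sum_(g in G) \tr (rS g) * \tr (rT g^-1%g) = 0.
Proof.
move=> irrS irrT nST; rewrite orthogonality_delta big1 // => i _.
rewrite big1 // => j _; set M := \sum_(g in G) _.
suff ->: M = 0 by rewrite mxE.
apply/eqP; apply/negPn/negP => nzM; apply: nST.
exact: intertwiner_rsim irrS irrT nzM (averageJ _ _ _).
Qed.

(** An eigenvalue [a] exists because the field is algebraically closed; [M - a%:M] is then a
    singular endomorphism of a simple module, hence zero. *)
Lemma irr_centg_scalar n (rS : reprG n) M :
    mx_irreducible rS -> centgmx rS M -> is_scalar_mx M.
Proof.
move=> irrS /centgmxP cM; have [n_gt0 _] := (mx_irrP rS).1 irrS.
have [a /eigenvalueP[v /eqP vM nzv]] :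
    exists a, eigenvalue M a.
  case: n => [|n] in rS irrS M cM n_gt0 *; first by [].
  have [|a ra] := closed_rootP (char_poly M) _.
    by rewrite size_char_poly.
  by exists a; rewrite eigenvalue_root_char.
apply/is_scalar_mxP; exists a; apply/eqP; rewrite -subr_eq0.
apply/negPn/negP => nz.
have: M - a%:M \in unitmx.
  apply: mx_Schur irrS _ _ nz; apply/centgmxP => x Gx.
  by rewrite mulmxBl mulmxBr cM // scalar_mxC.
rewrite -row_free_unit => /row_free_inj/(_ v 0); rewrite mul0mx mulmxBr.
rewrite (eqP vM) mul_mx_scalar subrr => /(_ erefl) v0.
by rewrite v0 eqxx in nzv.
Qed.

Lemma orthogonality_rsim n1 n2 (rS : reprG n1) (rT : reprG n2) :
    mx_irreducible rS -> mx_rsim rS rT ->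
  \sum_(g in G) \tr (rS g) * \tr (rT g^-1%g) = #|G|%:R.
Proof.
move=> irrS simST; have [n_gt0 _] := (mx_irrP rS).1 irrS.
have nz_n : n1%:R != 0 :> F by rewrite Num.Theory.pnatr_eq0 -lt0n.
under eq_bigr => g Gg do rewrite -(mxtrace_rsim simST) ?groupV //.
rewrite orthogonality_delta.
(* The average is scalar by Schur's lemma, and its trace, found by cyclicity, determines the
   scalar. *)
have avg i j : \sum_(g in G) rS g *m delta_mx i j *m rS g^-1%g
    = (#|G|%:R / n1%:R * (i == j)%:R)%:M.
  set M := \sum_(g in G) _.
  have [a Ma] : exists a, M = a%:M.
    apply/is_scalar_mxP; apply: irr_centg_scalar irrS _; apply/centgmxP => x Gx.
    by rewrite averageJ.
  have trM : \tr M = #|G|%:R * (i == j)%:R.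
    rewrite raddf_sum /= (eq_bigr (fun=> (i == j)%:R)) => [|g Gg].
      by rewrite sumr_const mulr_natl.
    rewrite mxtrace_mulC mulmxA -repr_mxM ?groupV // mulVg repr_mx1 mul1mx.
    rewrite /mxtrace (bigD1 i) //= big1 => [|k nki]; rewrite !mxE ?eqxx ?addr0 //.
    by rewrite (negPf nki).
  rewrite Ma; congr _%:M; apply: (mulfI nz_n).
  by rewrite mulrA mulrCA mulfV // mulr1 -trM Ma mxtrace_scalar mulr_natl.
rewrite (eq_bigr (fun=> #|G|%:R / n1%:R)) => [|i _].
  by rewrite sumr_const card_ord -[LHS]mulr_natr divfK.
under eq_bigr => j _ do rewrite avg mxE.
rewrite (bigD1 i) //= big1 => [|j nji]; last by rewrite eq_sym (negPf nji).
by rewrite eqxx addr0 mulr1n mulr1.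
Qed.

(** By Maschke's theorem [V] is the sum of its isotypic components, and orthogonality retains only
    those similar to [S]. This connects the multiplicity, defined through the socle, with traces. *)
Lemma multiplicity_trace (S V : representation F G) : mx_irreducible S ->
  \sum_(g in G) \tr (V g) * \tr (S g^-1%g) = (#|G| * multiplicity S V)%:R.
Proof.
move=> irrS; set sV := DecSocleType V.
have V1 : (Socle sV :=: 1%:M)%MS.
  by rewrite reducible_Socle1 //; apply: mx_Maschke_pchar; apply: pchar_pgroup.
under eq_bigr => g Gg.
  rewrite -(mxtrace_submod1 (Socle_module sV) V1) // mxtrace_Socle // mulr_suml.
  over.
rewrite exchange_big natrM /multiplicity natr_sum mulr_sumr [RHS]big_mkcond /=.
apply: eq_bigr => W _.
under eq_bigr => g _ do rewrite mulrnAl.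
rewrite sumrMnl; case: asboolP => [simWS | nsimWS].
  by rewrite (orthogonality_rsim (socle_irr W) simWS) mulr_natr.
by rewrite (orthogonality_not_rsim (socle_irr W) irrS nsimWS) mul0rn.
Qed.

Lemma mxtrace_dadd (V W : representation F G) g :
  \tr (dadd_grepr V W g) = \tr (V g) + \tr (W g).
Proof. exact: mxtrace_block. Qed.

Lemma mxtrace_dsum (I : finType) (V : I -> representation F G) g :
  \tr ((\big[dadd_grepr/grepr0]_i V i) g) = \sum_i \tr (V i g).
Proof.
elim/big_rec2: _ => [|i W x _ <-]; first by rewrite [LHS]big_ord0.
by rewrite mxtrace_dadd.
Qed.

Lemma mxtrace_muln (V : representation F G) k g :
  \tr (muln_grepr V k g) = \tr (V g) *+ k.
Proof. by rewrite mxtrace_dsum sumr_const card_ord. Qed.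

Lemma dadd_rsim (V V' W W' : representation F G) :
    mx_rsim V V' -> mx_rsim W W' ->
  mx_rsim (dadd_grepr V W) (dadd_grepr V' W').
Proof.
case: V V' W W' => [n V] [n' V'] [m W] [m' W'] [A /= nn fA homA] [B /= mm fB homB].
move: nn mm V' W' A B fA fB homA homB => <- <- V' W' A B fA fB homA homB.
exists (block_mx A 0 0 B) => //=.
  by rewrite row_free_unit unitmxE det_ublock unitrM -!unitmxE -!row_free_unit fA.
move=> x Gx; rewrite !mulmx_block !(mulmx0, mul0mx, addr0, add0r).
by rewrite homA ?homB.
Qed.

Lemma simple_split (V : representation F G) (M : 'M_(rdegree V)) :
    mxsimple V M ->
  exists W : representation F G, forall modM : mxmodule V M,
    mx_rsim V (dadd_grepr (Representation (submod_repr modM)) W).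
Proof.
move=> [modM nzM simM].
have [N modN defV dxV] := mx_Maschke_pchar V pchar_pgroup modM (submx1 M).
exists (Representation (submod_repr modN)) => modM'.
apply: mx_rsim_trans (mx_rsim_sym (rsim_submod1 (mxmodule1 V) _)) _ => //.
by apply: mx_rsim_dadd defV dxV _ _; apply: mx_rsim_refl.
Qed.

(* Induction on the degree: a simple submodule of [V] has the same nonzero
   multiplicity in [W], and splits off both by Maschke's theorem. *)
Lemma rsim_of_trace (V W : representation F G) :
  {in G, forall g, \tr (V g) = \tr (W g)} -> mx_rsim V W.
Proof.
have [m] := ubnP (rdegree V); elim: m => // m IHm in V W *; rewrite ltnS => leVm trVW.
have eqn : rdegree V = rdegree W.
  apply/eqP; rewrite -(Num.Theory.eqr_nat F) -!mxtrace1.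
  by rewrite -(repr_mx1 V) -(repr_mx1 W) trVW.
have [V0 | nzV] := posnP (rdegree V).
  case: V W => [n V] [k W] /= in V0 eqn trVW leVm *.
  move: V W trVW; rewrite -eqn V0 => V W _.
  by exists 0 => //= [|x _]; rewrite ?/row_free ?mxrank0 // mulmx0 mul0mx.
have [|M simM _] := dec_mxsimple_exists (mxmodule1 V).
  by rewrite -mxrank_eq0 mxrank1 -lt0n.
have modM := mxsimple_module simM.
pose S := Representation (submod_repr modM).
have irrS : mx_irreducible S by apply/submod_mx_irr.
have [V' /(_ modM) defV] := simple_split simM; rewrite -/S in defV.
have multW : multiplicity S W != 0%N.
  (* The sum is [#|G|] times one plus the multiplicity of [S] in [V']. *)
  have: \sum_(g in G) \tr (W g) * \tr (S g^-1%g) != 0.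
    rewrite (eq_bigr (fun g => \tr (S g) * \tr (S g^-1%g)
              + \tr (V' g) * \tr (S g^-1%g))); last first.
      by move=> g Gg; rewrite -trVW // (mxtrace_rsim defV) // mxtrace_dadd mulrDl.
    rewrite big_split /= (orthogonality_rsim irrS (mx_rsim_refl _)).
    rewrite (multiplicity_trace _ irrS) -natrD Num.Theory.pnatr_eq0 addn_eq0.
    by rewrite negb_and -lt0n cardG_gt0.
  rewrite (multiplicity_trace _ irrS) Num.Theory.pnatr_eq0 muln_eq0 negb_or.
  by case/andP.
have [N simN simNS] : exists2 N, mxsimple W N &
    forall modN : mxmodule W N, mx_rsim (submod_repr modN) S.
  have [/existsP[X /asboolP simXS] | noX] :=
    boolP [exists X : DecSocleType W, `[< mx_rsim (socle_repr X) S >]].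
    exists (socle_base X); first exact: socle_simple.
    move=> modN; apply: mx_rsim_trans _ simXS.
    by apply/mx_rsim_iso; apply: mx_iso_refl.
  case/negP: multW; rewrite /multiplicity big_pred0 // => X.
  by apply: contraNF noX => simX; apply/existsP; exists X.
have [W' /(_ (mxsimple_module simN)) defW] := simple_split simN.
set S' := Representation _ in defW; have simS'S : mx_rsim S' S by apply: simNS.
have trV'W' : {in G, forall g, \tr (V' g) = \tr (W' g)}.
  move=> g Gg; apply: (addrI (\tr (S g))).
  rewrite -mxtrace_dadd -(mxtrace_rsim defV) // trVW // (mxtrace_rsim defW) //.
  by rewrite mxtrace_dadd (mxtrace_rsim simS'S).
have simV'W' : mx_rsim V' W'.
  apply: IHm => //; apply: leq_trans leVm; rewrite (mxrank_rsim defV) /=.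
  rewrite -[ltnLHS]add0n ltn_add2r lt0n mxrank_eq0; case: simM => //.
apply: mx_rsim_trans defV _; apply: mx_rsim_trans (mx_rsim_sym defW).
exact: dadd_rsim (mx_rsim_sym simS'S) simV'W'.
Qed.

End Traces.

(** * Traces on spans of polytabloids *)

(** With [B] a basis of [U] and [Q] the coordinates, cyclicity of the trace moves [B] behind
    [p *m rG g], whose rows lie in [U], where [Q *m B] acts as the identity. *)
Lemma trace_submod_proj (F : fieldType) (gT : finGroupType) (G : {group gT}) n
    (rG : mx_representation F G n) (U : 'M_n) (modU : mxmodule rG U) (p : 'M_n) g :
    g \in G -> (p <= U)%MS -> U *m p = U ->
  \tr (submod_repr modU g) = \tr (p *m rG g).
Proof.
move=> Gg pU Up.
have [B [Q [-> BU QB]]] : exists B Q, [/\ submod_repr modU g = B *m rG g *m Q,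
    (B <= U)%MS & forall x : 'M_n, (x <= U)%MS -> x *m Q *m B = x].
  exists (val_submod 1%:M), (in_submod U 1%:M).
  split; [exact: in_submodE | by rewrite val_submod1 | move=> x xU].
  by rewrite -in_submodE -val_submodE in_submodK.
have Bp : B *m p = B by case/submxP: BU => y ->; rewrite -mulmxA Up.
rewrite -Bp -!mulmxA mxtrace_mulC !mulmxA QB //.
exact: submx_trans (submxMr _ pU) (mxmoduleP modU g Gg).
Qed.

Section Relabel.

Variables (F : numClosedFieldType) (b : nat) (nu : intpart b) (L : finType).
Local Notation fillings D := {set {ffun cell nu -> D}}.

Section Map.

Variable D : finType.

Definition relab_set (x : L -> D) (A : fillings L) : fillings D :=
  [set [ffun c => x (f c)] | f : {ffun cell nu -> L} in A].

(** The transport along a labelling. It carries the polytabloid of [t] to the one labelled by [x],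
    so a Foulkes space is a sum of transported Specht spaces. *)
Definition relab (x : L -> D) : 'M[F]_(#|{: fillings L}|, #|{: fillings D}|) :=
  \matrix_(i, j) (relab_set x (enum_val i) == enum_val j)%:R.

Lemma bvec_relab x A : bvec F A *m relab x = bvec F (relab_set x A).
Proof.
rewrite -rowE; apply/rowP => j; rewrite !mxE enum_rankK eqxx /=.
by congr (_%:R); rewrite -(inj_eq enum_rank_inj) enum_valK eq_sym.
Qed.

Lemma relab_set_tabloid x (f : {ffun cell nu -> L}) :
  relab_set x (tabloid f) = tabloid [ffun c => x (f c)].
Proof.
apply/setP => y; apply/imsetP/imsetP => [[z /imsetP[q qr ->] ->] | [q qr ->]].
  by exists q => //; apply/ffunP => c; rewrite !ffunE.
exists [ffun c => f (q c)]; first by apply/imsetP; exists q.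
by apply/ffunP => c; rewrite !ffunE.
Qed.

Lemma polytabloid_relab (t : {ffun cell nu -> L}) x :
  polytabloid F t id *m relab x = polytabloid F t x.
Proof.
rewrite mulmx_suml; apply: eq_bigr => p _.
rewrite -scalemxAl bvec_relab relab_set_tabloid; congr (_ *: bvec _ (tabloid _)).
by apply/ffunP => c; rewrite !ffunE.
Qed.

Lemma eq_relab x y : x =1 y -> relab x = relab y.
Proof.
move=> xy; apply/matrixP => i j; rewrite !mxE; congr (_ == _)%:R.
by apply: eq_imset => f; apply/ffunP => c; rewrite !ffunE xy.
Qed.

Lemma relab_act (gT : finGroupType) (to : {action gT &-> D}) x g :
  relab x *m tabloid_repr F nu to g = relab (fun l => to (x l) g).
Proof.
apply/row_matrixP => k; rewrite row_mul !rowE.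
rewrite -[k]enum_valK -/(bvec F _) !bvec_relab bvec_act.
congr (bvec _ _); rewrite /= /setact /relab_set -imset_comp.
by apply: eq_imset => f; apply/ffunP => c; rewrite !ffunE.
Qed.

Lemma perm_relab x (w : {perm L}) :
  tabloid_repr F nu 'P%act w *m relab x = relab (x \o w).
Proof.
apply/row_matrixP => k; rewrite row_mul !rowE.
rewrite -[k]enum_valK -/(bvec F _) bvec_act !bvec_relab; congr (bvec _ _).
rewrite /= /setact /relab_set -imset_comp.
by apply: eq_imset => f; apply/ffunP => c; rewrite !ffunE.
Qed.

Lemma bvec_relabT y (A : fillings D) j :
  (bvec F A *m (relab y)^T) 0 j = (relab_set y (enum_val j) == A)%:R.
Proof. by rewrite -rowE !mxE enum_rankK. Qed.

(** Relabelling along an injection is injective on sets of fillings, so the transpose of [relab x]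
    undoes [relab x]. *)
Lemma relab_perm x (w : {perm L}) : injective x ->
  relab (x \o w) *m (relab x)^T = tabloid_repr F nu 'P%act w.
Proof.
move=> injx; apply/row_matrixP => k; rewrite row_mul !rowE.
rewrite -[k]enum_valK -/(bvec F _) bvec_relab bvec_act.
apply/rowP => j; rewrite bvec_relabT !mxE eqxx /=.
rewrite -(inj_eq enum_val_inj) enum_rankK.
have -> : relab_set (x \o w) (enum_val k) =
    relab_set x (setact (ffun_action (cell nu) 'P%act) (enum_val k) w).
  rewrite /setact /relab_set -imset_comp.
  by apply: eq_imset => f; apply/ffunP => c; rewrite !ffunE.
rewrite (inj_eq (@imset_inj _ _ _ _)) // => f f' /ffunP ff'.
by apply/ffunP => c; apply: injx; have:= ff' c; rewrite !ffunE.
Qed.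

(* Tabloids relabelled by [x] and by [y] are distinct unless [x] and [y] have
   the same image. *)
Lemma relab_orth x y (t : {ffun cell nu -> L}) : is_tableau t -> injective x ->
    (forall w : {perm L}, ~ x =1 y \o w) ->
  polytabloid F t id *m relab x *m (relab y)^T = 0.
Proof.
move=> /andP[/injectiveP injt /forallP surjt] injx nxy.
rewrite polytabloid_relab mulmx_suml big1 // => p _.
rewrite -scalemxAl; apply/rowP => j; rewrite mxE bvec_relabT mxE.
case: eqP => [E | _]; last by rewrite mulr0.
have: [ffun c => x (p (t c))] \in relab_set y (enum_val j).
  rewrite E; apply/imsetP; exists 1%g; first by rewrite inE; apply/forallP => c;
    rewrite perm1.
  by apply/ffunP => c; rewrite !ffunE perm1.
case/imsetP => f _ /ffunP xf.
have surj l : exists c, p (t c) == l.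
  case/codomP: (surjt (p^-1%g l)) => c lc; exists c.
  by rewrite -lc permKV.
(* The filling [f], relabelled by [y], is [t] permuted by [p] and relabelled by [x]; it gives [w]
   with [x = y \o w], a permutation because [x] is injective. *)
pose w l := f (xchoose (surj l)).
have xw l : x l = y (w l).
  by have:= xf (xchoose (surj l)); rewrite !ffunE (eqP (xchooseP (surj l))).
have injw : injective w by move=> k l kl; apply: injx; rewrite !xw kl.
by case: (nxy (perm injw)) => l /=; rewrite permE.
Qed.

End Map.

(** Renaming the letters of [t] by [w] conjugates its column stabilizer by [w], and conjugation
    preserves signs. *)
Lemma polytabloid_perm (D : finType) (t : {ffun cell nu -> L}) (x : L -> D)
    (w : {perm L}) :
  polytabloid F [ffun c => w (t c)] x = polytabloid F t (x \o w).
Proof.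
rewrite /polytabloid [LHS](reindex_inj (conjg_inj w)) /=.
apply: eq_big => [p | p _].
  rewrite !inE; apply: eq_forallb => c; apply: eq_forallb => d.
  by rewrite !ffunE permJ (inj_eq perm_inj).
rewrite odd_permJ; congr (_ *: bvec _ (tabloid _)).
by apply/ffunP => c; rewrite !ffunE permJ.
Qed.

Lemma tableau_perm (t t' : {ffun cell nu -> L}) : is_tableau t -> is_tableau t' ->
  exists w : {perm L}, t' = [ffun c => w (t c)].
Proof.
move=> /andP[/injectiveP injt /forallP surjt] /andP[/injectiveP injt' _].
have surj l : exists c, t c == l.
  by case/codomP: (surjt l) => c lc; exists c; rewrite -lc.
pose w l := t' (xchoose (surj l)).
have tK l : t (xchoose (surj l)) = l := eqP (xchooseP (surj l)).
have injw : injective w by move=> k l /injt' kl; rewrite -(tK k) kl tK.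
exists (perm injw); apply/ffunP => c; rewrite ffunE permE /w.
by congr (t' _); apply: injt; rewrite tK.
Qed.

Variables (D : finType) (t : {ffun cell nu -> L}) (P : pred {ffun L -> D}).
Hypothesis tab_t : is_tableau t.
Hypothesis injP : forall X, P X -> injective X.
Hypothesis closP : forall X (w : {perm L}), P X -> P [ffun l => X (w l)].

Let U := (\sum_(X | P X) <<polytabloid F t X>>)%MS.
Let Sp := specht_space F nu L.
(** A linear projector onto the Specht space. *)
Let pi := pinvmx Sp *m Sp.

Let Spi m (v : 'M_(m, _)) : (v <= Sp)%MS -> v *m pi = v.
Proof. by move=> vS; rewrite mulmxA mulmxKpV. Qed.

Let sub_Sp t' : is_tableau t' -> (polytabloid F t' id <= Sp)%MS.
Proof.
by move=> ht'; apply: (sumsmx_sup t') => //; rewrite genmxE.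
Qed.

Lemma specht_relab_sub X : P X -> (Sp *m relab X <= U)%MS.
Proof.
move=> PX; rewrite sumsmxMr_gen; apply/sumsmx_subP => t' tab_t'.
rewrite genmxE (eqmxMr _ (genmxE _)) polytabloid_relab.
have [w ->] := tableau_perm tab_t tab_t'; rewrite polytabloid_perm.
have -> : polytabloid F t (X \o w) = polytabloid F t [ffun l => X (w l)].
  apply: eq_bigr => p _; congr (_ *: bvec _ (tabloid _)).
  by apply/ffunP => c; rewrite !ffunE.
by apply: (sumsmx_sup [ffun l => X (w l)]); rewrite ?closP ?genmxE.
Qed.

Lemma specht_relab_orth (x y : L -> D) : injective x ->
    (forall w : {perm L}, ~ x =1 y \o w) ->
  Sp *m relab x *m (relab y)^T = 0.
Proof.
move=> injx nxy; apply/eqP; rewrite -submx0 -mulmxA sumsmxMr_gen.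
apply/sumsmx_subP => t' tab_t'.
by rewrite genmxE (eqmxMr _ (genmxE _)) mulmxA relab_orth ?sub0mx.
Qed.

(* Each X in P contributes a projector onto the copy of the Specht space along
   X; the copies of X and Y agree when Y = X \o w and are orthogonal otherwise. *)
Let q : 'M[F]_#|{: fillings D}| :=
  #|{perm L}|%:R^-1 *: \sum_(X | P X) (relab X)^T *m pi *m relab X.

Let natL : #|{perm L}|%:R != 0 :> F.
Proof. by rewrite -cardsT; apply: natr_card_neq0. Qed.

Let q_sub : (q <= U)%MS.
Proof.
apply: scalemx_sub; apply: summx_sub => X PX.
rewrite -mulmxA; apply: submx_trans (submxMl _ _) _.
by rewrite /pi -mulmxA; apply: submx_trans (submxMl _ _) (specht_relab_sub PX).
Qed.

Let trace_pi w : \tr (pi *m tabloid_repr F nu 'P%act w) = \tr (specht F nu L w).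
Proof.
apply/esym; apply: (trace_submod_proj (specht_module F nu L)); rewrite ?inE //.
  exact: submxMl.
exact: Spi.
Qed.

(** Since [X] is injective the sum has at most one term; the empty sum is the orthogonal case.
    Written as a sum over [w], both cases can be summed over [X] together. *)
Lemma specht_relab_pair (X Y : {ffun L -> D}) : P X -> injective Y ->
  Sp *m relab Y *m (relab X)^T =
  \sum_(w : {perm L} | Y == [ffun l => X (w l)]) Sp *m tabloid_repr F nu 'P%act w.
Proof.
move=> PX injY; have injX := injP PX.
have [/existsP[w /eqP Yw] | noW] :=
    boolP [exists w : {perm L}, Y == [ffun l => X (w l)]].
  rewrite (big_pred1 w) => [|v]; last first.
    rewrite Yw; apply/eqP/eqP => [/ffunP vw | ->] //.
    by apply/permP => l; apply: injX; have := vw l; rewrite !ffunE.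
  rewrite -mulmxA -(relab_perm w injX); congr (_ *m (_ *m _)).
  by apply: eq_relab => l; rewrite Yw ffunE.
rewrite big_pred0 => [|w]; last first.
  by apply: contraNF noW => Yw; apply/existsP; exists w.
apply: specht_relab_orth => // w Yw; case/existsP: noW; exists w.
by apply/eqP/ffunP => l; rewrite Yw ffunE.
Qed.

(** For every [w] exactly one [X] in [P] satisfies [Y = X \o w], namely [Y \o w^-1]. All these terms
    are equal, and their number cancels the scalar in [q]. *)
Let specht_q Y : P Y -> Sp *m relab Y *m q = Sp *m relab Y.
Proof.
move=> PY; rewrite -scalemxAr mulmx_sumr.
have -> : \sum_(X | P X) Sp *m relab Y *m ((relab X)^T *m pi *m relab X)
    = \sum_(X | P X) \sum_(w : {perm L} | Y == [ffun l => X (w l)]) Sp *m relab Y.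
  apply: eq_bigr => X PX.
  rewrite -(mulmxA _ pi) mulmxA specht_relab_pair //; last exact: injP.
  rewrite mulmx_suml; apply: eq_bigr => w /eqP Yw.
  have Sw : (Sp *m tabloid_repr F nu 'P%act w <= Sp)%MS.
    by apply: (mxmoduleP (specht_module F nu L)); rewrite inE.
  rewrite mulmxA Spi // -mulmxA perm_relab; congr (_ *m _).
  by apply: eq_relab => l; rewrite Yw ffunE.
rewrite (exchange_big_dep xpredT) //=.
rewrite (eq_bigr (fun=> Sp *m relab Y)) => [|w _].
  rewrite sumr_const -scaler_nat scalerA mulVf ?scale1r //.
rewrite (big_pred1 [ffun l => Y (w^-1%g l)]) // => X.
apply/andP/eqP => [[PX /eqP ->] | ->].
  by apply/ffunP => l; rewrite !ffunE permKV.
split; first exact: closP.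
by apply/eqP/ffunP => l; rewrite !ffunE permK.
Qed.

(** The trace equals that of [q *m rG g]; moving [relab X] by [h] and pairing it with [(relab X)^T]
    leaves those [w] for which [h] moves [X] to [X \o w]. The representation [rG] is kept abstract
    so that restrictions to Young subgroups are covered as well. *)
Lemma trace_span (gT : finGroupType) (to : {action gT &-> D}) h
    (aT : finGroupType) (G : {group aT}) (rG : mx_representation F G _) 
    (modU : mxmodule rG U) g :
    g \in G -> rG g = tabloid_repr F nu to h ->
  \tr (submod_repr modU g) = #|{perm L}|%:R^-1 *
    \sum_(w : {perm L}) \tr (specht F nu L w) *+
       #|[set X | P X && ([ffun l => to (X l) h] == [ffun l => X (w l)])]|.
Proof.
move=> Gg rGg; rewrite (trace_submod_proj modU Gg q_sub); last first.
  apply/eqP; rewrite -subr_eq0 -{2}[U]mulmx1 -mulmxBr -submx0 sumsmxMr.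
  apply/sumsmx_subP => X PX; rewrite (eqmxMr _ (genmxE _)) mulmxBr mulmx1.
  rewrite -polytabloid_relab submx0 subr_eq0; have := sub_Sp tab_t.
  by case/submxP => y ->; rewrite -!(mulmxA y) specht_q.
rewrite -scalemxAl mxtraceZ; congr (_ * _); rewrite mulmx_suml raddf_sum /=.
have -> : \sum_(X | P X) \tr ((relab X)^T *m pi *m relab X *m rG g) =
    \sum_(X | P X) \sum_(w : {perm L} | [ffun l => to (X l) h] == [ffun l => X (w l)])
      \tr (specht F nu L w).
  apply: eq_bigr => X PX; rewrite rGg.
  rewrite -(mulmxA _ (relab X) (tabloid_repr F nu to h)) relab_act.
  rewrite -(mulmxA _ pi) mxtrace_mulC -mulmxA.
  have /eq_relab -> : (fun l => to (X l) h) =1 [ffun l => to (X l) h].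
    by move=> l; rewrite ffunE.
  rewrite -(mulmxA (pinvmx Sp)) (mulmxA Sp) specht_relab_pair //; last first.
    by move=> k l; rewrite !ffunE => /act_inj/(injP PX).
  rewrite mulmx_sumr raddf_sum /=.
  by apply: eq_bigr => w _; rewrite mulmxA trace_pi.
rewrite (exchange_big_dep xpredT) //=; apply: eq_bigr => w _.
by rewrite sumr_const; congr (_ *+ _); rewrite cardsE.
Qed.

End Relabel.

(** * Cycle types *)

Section CycleType.

Variable T : finType.
Implicit Types s : {perm T}.

Definition cycle_type s : seq nat :=
  sort geq (map (fun A : {set T} => #|A|) (enum (porbits s))).

Lemma cycle_type_is_part s : is_part #|T| (cycle_type s).
Proof.
apply/and3P; split.
- by apply: sort_sorted => m n; apply: leq_total.
- rewrite mem_sort; apply/mapP => -[A]; rewrite mem_enum => /imsetP[x _ ->].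
  by move/esym/eqP; rewrite (negPf (card_porbit_neq0 s x)).
rewrite (perm_sumn (permEl (perm_sort _ _))) sumnE big_map big_enum /=.
have defT : partition (porbits s) [set: T].
  apply/and3P; split.
  - apply/eqP/setP => x; rewrite inE; apply/bigcupP.
    by exists (porbit s x); rewrite ?porbit_id ?imset_f.
  - apply/trivIsetP => _ _ /imsetP[x _ ->] /imsetP[y _ ->] nxy.
    rewrite -setI_eq0; apply: contraNT nxy => /set0Pn[z /setIP[xz yz]].
    rewrite -eq_porbit_mem in xz; rewrite -eq_porbit_mem in yz.
    by rewrite -(eqP xz) -(eqP yz).
  apply/imsetP => -[x _ /setP/(_ x)].
  by rewrite porbit_id inE.
by rewrite -(card_partition defT) cardsT.
Qed.

(** Iterating [s] from [y] is periodic with period the orbit length, without repetition inside a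
    period. *)
Lemma expperm_eq s y j k :
  ((s ^+ j)%g y == (s ^+ k)%g y) = (j == k %[mod #|porbit s y|]).
Proof.
set m := #|_|; have m_gt0 : (0 < m)%N by rewrite lt0n card_porbit_neq0.
have fixm q : (s ^+ (q * m))%g y = y.
  elim: q => [|q IHq]; first by rewrite mul0n perm1.
  by rewrite mulSn expgD permM [X in (s ^+ _)%g X]permX iter_porbit.
have redm i : (s ^+ i)%g y = nth y (traject s y m) (i %% m).
  by rewrite nth_traject ?ltn_mod // {1}(divn_eq i m) expgD permM fixm permX.
by rewrite !redm nth_uniq ?uniq_traject_porbit // size_traject ltn_mod.
Qed.

(** Orbits of equal rank in the two lists sorted by size are matched; [p] sends the k-th iterate of
    a base point to the k-th iterate of the base point of the matching orbit. *)
Lemma cycle_type_conj s s' : cycle_type s = cycle_type s' ->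
  exists p, s' = (s ^ p)%g.
Proof.
set card := fun A : {set T} => #|A|.
rewrite /cycle_type !sort_map -/card.
set E := sort _ _ => eqct; set E' := sort _ _ in eqct.
have memE A : (A \in E) = (A \in porbits s) by rewrite mem_sort mem_enum.
have memE' A : (A \in E') = (A \in porbits s') by rewrite mem_sort mem_enum.
have uniqE : uniq E by rewrite sort_uniq enum_uniq.
have uniqE' : uniq E' by rewrite sort_uniq enum_uniq.
have szE : size E = size E' by rewrite -(size_map card) eqct size_map.
pose f A := nth set0 E' (index A E).
have fP A : A \in porbits s -> f A \in porbits s'.
  by move=> sA; rewrite -memE' mem_nth // -szE index_mem memE.
have fcard A : A \in porbits s -> #|f A| = #|A|.
  rewrite -memE => EA; rewrite -[LHS]/(card _) -(nth_map _ 0%N) -?szE ?index_mem //.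
  by rewrite -eqct (nth_map set0) ?index_mem // nth_index.
have finj : {in porbits s &, injective f}.
  move=> A B; rewrite -!memE => EA EB /eqP.
  rewrite nth_uniq -?szE ?index_mem // => /eqP iAB.
  by rewrite -(nth_index set0 EA) iAB nth_index.
have porb (r : {perm T}) x : porbit r x \in porbits r by rewrite imset_f.
(* Both base points depend on the orbit alone; the default of [odflt] never occurs, since orbits are
   nonempty. *)
pose base x := odflt x [pick y in porbit s x].
pose base' x := odflt x [pick y in f (porbit s x)].
have baseP x : porbit s (base x) = porbit s x.
  rewrite /base; case: pickP => [y | /(_ x)]; last by rewrite porbit_id.
  by rewrite -eq_porbit_mem => /eqP.
have base'P x : porbit s' (base' x) = f (porbit s x).
  have /imsetP[z _ fx] := fP _ (porb s x).
  rewrite /base'; case: pickP => [y | /(_ z)]; last by rewrite fx porbit_id.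
  by rewrite fx -eq_porbit_mem => /eqP.
have base_eq x y : porbit s x = porbit s y -> base x = base y /\ base' x = base' y.
  move=> xy; rewrite /base /base' -xy; split.
    by case: pickP => // /(_ x); rewrite porbit_id.
  have /imsetP[z _ fx] := fP _ (porb s x).
  by case: pickP => // /(_ z); rewrite fx porbit_id.
have ex x : exists k, (s ^+ k)%g (base x) == x.
  have: x \in porbit s (base x) by rewrite baseP porbit_id.
  by case/porbitP => k xk; exists k; rewrite -xk.
pose k x := xchoose (ex x).
have kP x : (s ^+ k x)%g (base x) = x by apply/eqP/(xchooseP (ex x)).
clearbody k; pose p x := (s' ^+ k x)%g (base' x).
(* Matched orbits have the same length, so any exponent leading from the base point to [x] may
   replace [k x]. *)
have pE x j : (s ^+ j)%g (base x) = x -> p x = (s' ^+ j)%g (base' x).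
  move=> jx; apply/eqP; rewrite expperm_eq base'P fcard ?porb // -baseP.
  by rewrite -expperm_eq kP jx.
have p_orb x : porbit s' (p x) = f (porbit s x) by rewrite porbit_perm base'P.
have injp : injective p.
  move=> x y pxy.
  have xy : porbit s x = porbit s y.
    by apply: finj; rewrite ?porb // -!p_orb pxy.
  have [bxy b'xy] := base_eq x y xy.
  rewrite -(kP x) -(kP y) bxy.
  apply/eqP; rewrite expperm_eq baseP -fcard ?porb // -base'P -expperm_eq.
  by apply/eqP; rewrite -[in LHS]b'xy.
exists (perm injp); apply/permP => x; rewrite -[x](permKV (perm injp)).
set y := (perm injp)^-1%g x; rewrite permJ !permE.
have sy : porbit s (s y) = porbit s y by rewrite (porbit_perm s 1 y).
have [bsy b'sy] := base_eq _ _ sy.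
by rewrite (pE (s y) (k y).+1) ?b'sy ?bsy expgSr permM ?kP.
Qed.

End CycleType.

(** Permutations with the same cycle type are conjugate, so a class is determined by the partition
    of its representative. *)
Lemma card_classes_Sym_leq b : (#|classes [set: 'S_b]| <= #|{: intpart b}|)%N.
Proof.
have ex (s : 'S_b) : exists nu : intpart b, parts nu == cycle_type s.
  have := cycle_type_is_part s; rewrite card_ord.
  by case/intpart_complete => nu <-; exists nu.
pose f (C : {set 'S_b}) := xchoose (ex (repr C)).
rewrite -(card_in_imset (f := f)) ?max_card //.
move=> _ _ /imsetP[x _ ->] /imsetP[y _ ->] fxy.
have: cycle_type (repr (x ^: [set: 'S_b])) = cycle_type (repr (y ^: [set: 'S_b])).
  by rewrite -(eqP (xchooseP (ex _))) -/(f _) fxy (eqP (xchooseP (ex _))).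
have [[g _ ->] [h _ ->]] := (repr_class [set: 'S_b] x, repr_class [set: 'S_b] y).
case/cycle_type_conj => p; rewrite -conjgM => xy; apply/class_eqP.
by rewrite -(classGidl y (in_setT h)) xy classGidl ?inE // class_refl.
Qed.

(** * Comparison of Young diagrams *)

Section Diagrams.

Variable b : nat.
Implicit Types la mu : intpart b.

Lemma part_nth_leq la i : (nth 0%N (parts la) i <= b)%N.
Proof.
case/and3P: (valP la) => _ _ /eqP lab; rewrite -/(parts la) in lab.
have [lti | gei] := ltnP i (size (parts la)); last by rewrite nth_default.
by rewrite -[leqRHS]lab sumn_ge_mem // mem_nth.
Qed.

Lemma part_nth_decr la i j :
  (i <= j)%N -> (nth 0%N (parts la) j <= nth 0%N (parts la) i)%N.
Proof.
case/and3P: (valP la) => srt _ _ ij; rewrite -/(parts la) in srt.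
have [ltj | gej] := ltnP j (size (parts la)); last by rewrite nth_default.
have geq_trans : transitive geq by move=> y x z /= xy yz; apply: leq_trans yz xy.
apply: (sorted_leq_nth geq_trans _ _ srt) => //; first by move=> k; apply: leqnn.
exact: leq_ltn_trans ij ltj.
Qed.

Lemma intpart_inj la mu :
  (forall i : 'I_b, nth 0%N (parts la) i = nth 0%N (parts mu) i) -> la = mu.
Proof.
move=> eqn; have szb (nu : intpart b) : (size (parts nu) <= b)%N.
  case/and3P: (valP nu) => _ n0 /eqP nb; rewrite -/(parts nu) in n0 nb.
  by rewrite -[leqRHS]nb sumn_ge_size.
have le_size (nu nu' : intpart b) :
    (forall i : 'I_b, nth 0%N (parts nu) i = nth 0%N (parts nu') i) ->
    (size (parts nu) <= size (parts nu'))%N.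
  move=> eqnn; rewrite leqNgt; apply/negP => lt.
  have ltb := leq_trans lt (szb nu).
  (* At the index where [nu'] ends, [nu] would agree with the default value 0, which is not a
     part. *)
  case/and3P: (valP nu) => _ /negP[]; rewrite -/(parts nu).
  have:= eqnn (Ordinal ltb); rewrite /= [RHS]nth_default // => <-.
  exact: mem_nth.
have eqs : parts la = parts mu.
  apply: (@eq_from_nth _ 0%N) => [|i lti].
    by apply/eqP; rewrite eqn_leq !le_size.
  exact: (eqn (Ordinal (leq_trans lti (szb la)))).
by do 2!apply: val_inj; apply: (inj_map val_inj).
Qed.

Lemma cell_inj la (c d : cell la) :
  row_of c = row_of d -> col_of c = col_of d -> c = d.
Proof.
move=> rcd ccd; apply: val_inj; case: c d rcd ccd => [[i j] ?] [[k l] ?].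
by rewrite /row_of /col_of /= => -> ->.
Qed.

Lemma card_row la (i : 'I_b) :
  #|[set c : cell la | row_of c == i]| = nth 0%N (parts la) i.
Proof.
have leb := part_nth_leq la i.
pose f (j : 'I_(nth 0%N (parts la) i)) : cell la :=
  Sub (i, widen_ord leb j) (ltn_ord j).
rewrite -[RHS]card_ord -cardsT -(card_imset (f := f)); last first.
  move=> j k /(congr1 (@col_of _ _)) /(congr1 val) /= jk; exact: val_inj.
apply: eq_card => c; rewrite inE; apply/eqP/imsetP => [rc | [j _ ->] //].
have ltc : (col_of c < nth 0%N (parts la) i)%N by rewrite -rc; apply: (valP c).
by exists (Ordinal ltc) => //; apply: cell_inj; last apply: val_inj.
Qed.

(** The classical statistic n(la), the sum of (i-1) la_i; it takes the place of the dominance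
    order. *)
Definition row_sum la := (\sum_(c : cell la) row_of c)%N.

Section Compare.

Variables (la mu : intpart b) (s : cell la -> cell mu).
Hypothesis bij_s : bijective s.
Hypothesis inj_rc : forall c d : cell la,
  col_of c = col_of d -> row_of (s c) = row_of (s d) -> c = d.

(* [phi] moves each cell of [la] within its column to the row prescribed by [s].
   A position x satisfies height (column of x) <= row x + g x, with equality on
   the diagram of [la], outside of which g vanishes; summing over the image of
   [phi] and over the diagram compares the sums of the row indices. *)
Let phi c : 'I_b * 'I_b := (row_of (s c), col_of c).
Let h (j : 'I_b) := #|[set c : cell la | col_of c == j]|.
Let g (x : 'I_b * 'I_b) :=
  #|[set c : cell la | (col_of c == x.2) && (x.1 <= row_of c)%N]|.

Let inj_phi : injective phi.
Proof. by move=> c d [rcd ccd]; apply: inj_rc. Qed.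

Let split_col (x : 'I_b * 'I_b) :
  (h x.2 = g x + #|[set c : cell la | (col_of c == x.2) && (row_of c < x.1)%N]|)%N.
Proof.
rewrite /h /g -(cardsID [set c : cell la | (x.1 <= row_of c)%N]); congr (_ + _)%N.
  by apply: eq_card => c; rewrite !inE.
by apply: eq_card => c; rewrite !inE -ltnNge andbC.
Qed.

(** Cells of one column lie in distinct rows, so at most [x.1] of them lie above row [x.1]. *)
Let h_le (x : 'I_b * 'I_b) : (h x.2 <= x.1 + g x)%N.
Proof.
rewrite split_col addnC leq_add2r -[leqRHS]card_ord -[leqRHS]cardsT.
have [b0 | ltx] := posnP x.1.
  by rewrite [X in (X <= _)%N]eq_card0 // => c; rewrite !inE b0 ltn0 andbF.
pose f (c : cell la) : 'I_x.1 := insubd (Ordinal ltx) (val (row_of c)).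
rewrite -(card_in_imset (f := f)) ?subset_leq_card ?subsetT //.
move=> c d /[!inE] /andP[/eqP cc rc] /andP[/eqP cd rd] /(congr1 val).
rewrite !val_insubd rc rd => rcd; apply: cell_inj; last by rewrite cc.
exact: val_inj.
Qed.

(** Parts decrease, so every row above [c] has a cell in the column of [c]. *)
Let h_cell (c : cell la) : h (col_of c) = (row_of c + g (row_of c, col_of c))%N.
Proof.
apply/eqP; rewrite eqn_leq (h_le (row_of c, col_of c)) /=.
rewrite (split_col (row_of c, col_of c)) addnC leq_add2l /=.
have ltb (i : 'I_(row_of c)) : (i < b)%N.
  exact: (ltn_trans (ltn_ord i) (ltn_ord (row_of c))).
have ltp (i : 'I_(row_of c)) : (col_of c < nth 0%N (parts la) (Ordinal (ltb i)))%N.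
  by apply: leq_trans (valP c) _; apply: part_nth_decr; apply: ltnW (ltn_ord i).
pose f (i : 'I_(row_of c)) : cell la := Sub (Ordinal (ltb i), col_of c) (ltp i).
rewrite -[leqLHS]card_ord -cardsT -(card_imset (f := f)); last first.
  by move=> i j /(congr1 (@row_of _ _)) /(congr1 val) /= ij; apply: val_inj.
apply/subset_leq_card/subsetP => _ /imsetP[i _ ->]; rewrite inE /=.
by rewrite /f /col_of /row_of /= eqxx ltn_ord.
Qed.

Let diag := [set sval c | c : cell la].
Let img := [set phi c | c : cell la].

Let g_out x : x \notin diag -> g x = 0%N.
Proof.
move=> nx; apply: eq_card0 => c; rewrite !inE; apply: contraNF nx => /andP[/eqP cc rc].
have ltp : (x.2 < nth 0%N (parts la) x.1)%N.
  by rewrite -cc; apply: leq_trans (valP c) _; apply: part_nth_decr.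
by apply/imsetP; exists (Sub x ltp).
Qed.

Let g_in x : x \in diag -> (0 < g x)%N.
Proof.
case/imsetP => c _ ->; rewrite card_gt0; apply/set0Pn; exists c.
by rewrite inE /= eqxx /row_of leqnn.
Qed.

Let sum_img : (\sum_(c : cell la) g (phi c) = \sum_(x in diag :&: img) g x)%N.
Proof.
transitivity (\sum_(x in img) g x)%N.
  by rewrite big_imset /= => [|c d _ _ /inj_phi].
rewrite (big_setID diag) setIC.
rewrite [X in (_ + X)%N = _]big1 => [|x /setDP[_ nx]]; last exact: g_out.
exact: addn0.
Qed.

Let sum_diag : (\sum_(c : cell la) g (row_of c, col_of c) =
  \sum_(x in diag :&: img) g x + \sum_(x in diag :\: img) g x)%N.
Proof.
rewrite -(big_setID img) big_imset /= => [|c d _ _]; last exact: val_inj.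
by apply: eq_bigr => c _; rewrite /row_of /col_of; case: (sval c).
Qed.

Let sum_rows : row_sum mu = (\sum_(c : cell la) row_of (s c))%N.
Proof. by case: bij_s => r sr rs; rewrite /row_sum (reindex s) //; exists r => ? _. Qed.

(** Sum [h (col_of c)] over the cells, using [h_cell] on one side and [h_le] at [phi c] on the
    other, and cancel the common values of [g]. *)
Let sum_rows_ge :
  (row_sum la + \sum_(x in diag :\: img) g x <= row_sum mu)%N.
Proof.
rewrite -(leq_add2r (\sum_(x in diag :&: img) g x)) -addnA [X in (_ + X)%N]addnC.
rewrite -sum_diag -sum_img sum_rows -!big_split /=.
apply: leq_sum => c _; rewrite -h_cell; exact: (h_le (phi c)).
Qed.

Lemma row_sum_leq : (row_sum la <= row_sum mu)%N.
Proof. exact: leq_trans (leq_addr _ _) sum_rows_ge. Qed.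

(** Equality forces [g] to vanish on the diagram outside the image of [phi]; as [g] is positive on
    the diagram, [phi] permutes it. *)
Lemma row_sum_eq : (row_sum mu <= row_sum la)%N ->
  exists2 r : {perm cell la}, forall c, row_of (r c) = row_of (s c)
                            & forall c, col_of (r c) = col_of c.
Proof.
move=> le; have := leq_trans sum_rows_ge le; rewrite -[leqRHS]addn0 leq_add2l leqn0.
rewrite sum_nat_eq0 => /forall_inP D0.
have sub : diag \subset img.
  apply/subsetP => x dx; apply: contraT => nx.
  by have := g_in dx; rewrite lt0n D0 // inE nx.
have eqdi : diag = img.
  apply/eqP; rewrite eqEcard sub !card_imset //=; move=> c d; exact: val_inj.
have phiP c : exists d : cell la, sval d == phi c.
  have: phi c \in diag by rewrite eqdi imset_f.
  by case/imsetP => d _ ->; exists d.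
pose r c := xchoose (phiP c).
have rP c : sval (r c) = phi c := eqP (xchooseP (phiP c)).
have injr : injective r by move=> c d cd; apply: inj_phi; rewrite -!rP cd.
by exists (perm injr) => c; rewrite permE /row_of /col_of rP.
Qed.

Lemma row_sum_eq_part : (row_sum mu <= row_sum la)%N -> la = mu.
Proof.
case/row_sum_eq => r rr _; apply: intpart_inj => i; rewrite -!card_row.
rewrite -(card_preimset _ (@perm_inj _ r)).
rewrite -[RHS](on_card_preimset (onW_bij _ bij_s)).
by apply: eq_card => c; rewrite !inE rr.
Qed.

End Compare.
End Diagrams.

(** * Specht modules are irreducible and pairwise non-isomorphic *)

Lemma tableau_inv b (nu : intpart b) (L : finType) (t : {ffun cell nu -> L}) :
  is_tableau t -> exists2 s : L -> cell nu, cancel t s & cancel s t.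
Proof.
case/andP => /injectiveP injt /forallP surjt.
have surj l : exists c, t c == l.
  by case/codomP: (surjt l) => c lc; exists c; rewrite -lc.
have tK l : t (xchoose (surj l)) = l := eqP (xchooseP (surj l)).
by exists (fun l => xchoose (surj l)) => // c; apply: injt; rewrite tK.
Qed.

Lemma tableau_comp b (nu : intpart b) (L : finType) (t : {ffun cell nu -> L})
    (p : {perm L}) :
  is_tableau t -> is_tableau [ffun c => p (t c)].
Proof.
case/andP=> /injectiveP injt /forallP surjt; apply/andP; split.
  by apply/injectiveP => c d; rewrite !ffunE => /perm_inj /injt.
apply/forallP => l; case/codomP: (surjt (p^-1%g l)) => c lc.
by apply/codomP; exists c; rewrite ffunE -lc permKV.
Qed.

Lemma tabloid_row_perm b (nu : intpart b) (L : finType) (f : {ffun cell nu -> L})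
    (q : {perm cell nu}) :
  (forall c, row_of (q c) = row_of c) -> tabloid [ffun c => f (q c)] = tabloid f.
Proof.
move=> qr; apply/setP => y; apply/imsetP/imsetP => -[r]; rewrite inE => /forallP rr ->.
  exists (r * q)%g; first by rewrite inE; apply/forallP => c; rewrite permM qr rr.
  by apply/ffunP => c; rewrite !ffunE permM.
exists (r * q^-1)%g.
  rewrite inE; apply/forallP => c; rewrite permM -(eqP (rr c)).
  by rewrite -[in X in _ == X](permKV q (r c)) qr.
by apply/ffunP => c; rewrite !ffunE permM permKV.
Qed.

Lemma col_stabE b (nu : intpart b) (L : finType) (t : {ffun cell nu -> L}) s p :
    cancel t s -> cancel s t ->
  (p \in col_stab t) = [forall l, col_of (s (p l)) == col_of (s l)].
Proof.
move=> ts st; rewrite inE; apply/forallP/forallP => [cs l | cs c].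
  have /forallP/(_ (s (p l)))/implyP := cs (s l).
  by rewrite !st eqxx => /(_ isT).
apply/forallP => d; apply/implyP => /eqP td.
by have := cs (t c); rewrite -td !ts.
Qed.

Section Kappa.

Variables (F : numClosedFieldType) (b : nat) (L : finType).
Implicit Types la mu : intpart b.

(** The signed column sum of [t], acting on fillings of another shape [mu] too, which is how two
    shapes are compared. *)
Definition kappa la (t : {ffun cell la -> L}) mu :=
  \sum_(p in col_stab t)
     (-1) ^+ odd_perm p *: tabloid_repr F mu ('P%act : {action {perm L} &-> L}) p.

Local Notation rep mu := (tabloid_repr F mu ('P%act : {action {perm L} &-> L})).

Lemma polytabloid_kappa la (t : {ffun cell la -> L}) :
  polytabloid F t id = bvec F (tabloid t) *m kappa t la.
Proof.
rewrite mulmx_sumr; apply: eq_bigr => p _; rewrite -scalemxAr.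
by rewrite bvec_act tabloid_act.
Qed.

Section OneTableau.

Variables (la : intpart b) (t : {ffun cell la -> L}).
Hypothesis tab_t : is_tableau t.

Lemma col_stab_mull p r : p \in col_stab t ->
  ((p * r)%g \in col_stab t) = (r \in col_stab t).
Proof.
have [s ts st] := tableau_inv tab_t; rewrite !(col_stabE _ ts st) => /forallP pt.
apply/forallP/forallP => rt l; last by rewrite permM (eqP (rt _)) (eqP (pt _)).
rewrite -(permKV p l); set k := (p^-1)%g l.
by rewrite -[X in col_of (s X)]permM (eqP (rt k)) eq_sym.
Qed.

Lemma kappa_mull mu p : p \in col_stab t ->
  rep mu p *m kappa t mu = (-1) ^+ odd_perm p *: kappa t mu.
Proof.
move=> pt; rewrite [in RHS]/kappa (reindex_inj (mulgI p)) mulmx_sumr scaler_sumr.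
apply: eq_big => r; first by rewrite col_stab_mull.
move=> _; rewrite -scalemxAr -repr_mxM ?inE // scalerA odd_permM signr_addb.
by rewrite mulrA -signr_addb addbb mul1r.
Qed.

Lemma kappa_kappa mu : kappa t mu *m kappa t mu = #|col_stab t|%:R *: kappa t mu.
Proof.
rewrite {1}/kappa mulmx_suml (eq_bigr (fun=> kappa t mu)) => [|p pt].
  by rewrite sumr_const scaler_nat.
by rewrite -scalemxAl kappa_mull // scalerA -signr_addb addbb scale1r.
Qed.

(** The tabloid of [t] has coefficient 1: a column permutation that also preserves rows is
    trivial. *)
Lemma polytabloid_neq0 : polytabloid F t id != 0.
Proof.
have [injt _] := andP tab_t; move/injectiveP: injt => injt.
have [s ts st] := tableau_inv tab_t.
apply/eqP => /rowP/(_ (enum_rank (tabloid t))); rewrite mxE summxE.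
have t1 : 1%g \in col_stab t.
  by rewrite (col_stabE _ ts st); apply/forallP => l; rewrite perm1.
rewrite (bigD1 1%g) //= big1 => [|p /andP[pt np1]].
  rewrite odd_perm1 scale1r mxE eqxx /= addr0.
  have -> : [ffun c => id ((1%g : {perm L}) (t c))] = t.
    by apply/ffunP => c; rewrite ffunE perm1.
  by rewrite eqxx => /eqP; rewrite oner_eq0.
rewrite mxE /bvec mxE eqxx /= (inj_eq enum_rank_inj).
case: eqP => [E | _]; last by rewrite mulr0.
have: [ffun c => id (p (t c))] \in tabloid t.
  rewrite E; apply/imsetP; exists 1%g.
    by rewrite inE; apply/forallP => c; rewrite perm1.
  by apply/ffunP => c; rewrite !ffunE perm1.
case/imsetP => q; rewrite inE => /forallP qr /ffunP pq.
case/eqP: np1; apply/permP => l; rewrite perm1 -(st l).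
have pl : p (t (s l)) = t (q (s l)) by have := pq (s l); rewrite !ffunE.
rewrite pl; congr (t _); apply: cell_inj; first exact: eqP (qr _).
move: pt; rewrite (col_stabE _ ts st) => /forallP/(_ (t (s l))).
by rewrite pl !ts => /eqP.
Qed.

Section OtherTableau.

Variables (mu : intpart b) (t' : {ffun cell mu -> L}) (s' : L -> cell mu).
Hypotheses (t's' : cancel t' s') (s't' : cancel s' t').

(** If two letters share a column of [t] and a row of [t'], their transposition fixes the tabloid of
    [t'] but changes the sign of [kappa], so the product vanishes. *)
Lemma kappa_nz_inj : bvec F (tabloid t') *m kappa t mu != 0 ->
  forall c d : cell la, col_of c = col_of d ->
    row_of (s' (t c)) = row_of (s' (t d)) -> c = d.
Proof.
have [s ts st] := tableau_inv tab_t; move=> nz c d cd rcd; apply: contraNeq nz => ncd.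
pose x := tperm (t c) (t d).
have xt : x \in col_stab t.
  rewrite (col_stabE _ ts st); apply/forallP => l; rewrite /x.
  by case: tpermP => [->|->|_ _]; rewrite ?ts ?cd.
have x_odd : odd_perm x by rewrite odd_tperm (can_eq ts).
have fix_x : bvec F (tabloid t') *m rep mu x = bvec F (tabloid t').
  rewrite bvec_act tabloid_act; congr (bvec _ _).
  rewrite -(@tabloid_row_perm _ _ _ t' (tperm (s' (t c)) (s' (t d)))).
    congr tabloid; apply/ffunP => e; rewrite !ffunE.
    by rewrite (inj_tperm _ _ _ (can_inj t's')) !s't'.
  by move=> e; case: tpermP => [->|->|].
have: bvec F (tabloid t') *m kappa t mu = - (bvec F (tabloid t') *m kappa t mu).
  by rewrite -{1}fix_x -mulmxA kappa_mull // x_odd expr1 scaleN1r mulmxN.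
move/eqP; rewrite -addr_eq0 -mulr2n -scaler_nat scaler_eq0.
by rewrite Num.Theory.pnatr_eq0.
Qed.

End OtherTableau.

Lemma kappa_same_shape (t' : {ffun cell la -> L}) : is_tableau t' ->
  (bvec F (tabloid t') *m kappa t la <= polytabloid F t id)%MS.
Proof.
move=> tab_t'; have [-> | nz] := eqVneq (bvec F (tabloid t') *m kappa t la) 0.
  exact: sub0mx.
have [s ts st] := tableau_inv tab_t; have [s' t's' s't'] := tableau_inv tab_t'.
have bij_s : bijective (s' \o t).
  by exists (s \o t') => c /=; rewrite ?s't' ?t's' ?ts ?st ?t's'.
(* Both diagrams are [la], so the row sums agree. The resulting column permutation [p] carries the
   tabloid of [t'] to that of [t], and the product is the polytabloid of [t] up to sign. *)
have [r rr rc] := row_sum_eq bij_s (kappa_nz_inj t's' s't' nz) (leqnn _).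
have injp : injective (fun l => t (r (s l))).
  by move=> k l /(can_inj ts)/perm_inj/(can_inj st).
pose p := perm injp.
have pt : p \in col_stab t.
  by rewrite (col_stabE _ ts st); apply/forallP => l; rewrite permE ts rc.
have Et' : bvec F (tabloid t') *m rep la p = bvec F (tabloid t).
  rewrite bvec_act tabloid_act; congr (bvec _ _).
  have injq : injective (fun c => r (s (t' c))).
    by move=> c d /perm_inj/(can_inj st)/(can_inj t's').
  rewrite -(@tabloid_row_perm _ _ _ t (perm injq)) => [|c].
    by congr tabloid; apply/ffunP => c; rewrite !ffunE permE /= apermE permE.
  by rewrite permE rr /= st t's'.
have := kappa_mull la pt; move/(congr1 (mulmx (bvec F (tabloid t')))).
rewrite mulmxA Et' -polytabloid_kappa -scalemxAr => ->.
by rewrite eqmx_scale ?signr_eq0.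
Qed.

Lemma specht_kappa : (specht_space F la L *m kappa t la <= polytabloid F t id)%MS.
Proof.
rewrite sumsmxMr; apply/sumsmx_subP => t' tab_t'.
rewrite (eqmxMr _ (genmxE _)) mulmx_suml; apply: summx_sub => p _.
rewrite -scalemxAl scalemx_sub //; apply: kappa_same_shape.
by have := tableau_comp p tab_t'.
Qed.

Lemma polytabloid_sub : (polytabloid F t id <= specht_space F la L)%MS.
Proof. by apply: (sumsmx_sup t) => //; rewrite genmxE. Qed.

Lemma specht_sub m (V : 'M_(m, _)) :
  mxmodule (rep la) V -> (polytabloid F t id <= V)%MS -> (specht_space F la L <= V)%MS.
Proof.
move=> modV tV; apply/sumsmx_subP => t' tab_t'; rewrite genmxE.
have [w ->] := tableau_perm tab_t tab_t'; rewrite polytabloid_perm.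
rewrite -(@polytabloid_act F b la _ L L 'P%act t id _ w) //.
by apply: submx_trans (submxMr _ tV) (mxmoduleP modV _ _); rewrite inE.
Qed.

Lemma polytabloid_kappa_mul :
  polytabloid F t id *m kappa t la = #|col_stab t|%:R *: polytabloid F t id.
Proof. by rewrite polytabloid_kappa -mulmxA kappa_kappa scalemxAr. Qed.

Lemma col_stab_neq0 : #|col_stab t|%:R != 0 :> F.
Proof.
have [s ts st] := tableau_inv tab_t.
rewrite Num.Theory.pnatr_eq0 -lt0n card_gt0; apply/set0Pn; exists 1%g.
by rewrite (col_stabE _ ts st); apply/forallP => l; rewrite perm1.
Qed.

Lemma kappa_module m (V : 'M_(m, _)) :
  mxmodule (rep la) V -> (V *m kappa t la <= V)%MS.
Proof.
move=> modV; rewrite mulmx_sumr; apply: summx_sub => p _.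
by rewrite -scalemxAr scalemx_sub // (mxmoduleP modV) ?inE.
Qed.

(* [kappa t] maps the Specht space to the line of [e_t] and is nonzero on [e_t],
   so of two complementary submodules one has a nonzero image, hence contains
   [e_t], which generates. *)
Lemma specht_simple : mxsimple (rep la) (specht_space F la L).
Proof.
split; first exact: specht_module.
  by apply: contraTneq polytabloid_sub => ->; rewrite submx0 polytabloid_neq0.
move=> V modV sVS nzV; have modS := specht_module F la L.
have redS : mx_completely_reducible (rep la) (specht_space F la L).
  apply: (mx_reducibleS modS (submx1 _)).
  by apply: mx_Maschke_pchar; apply: pchar_pgroup.
have [W modW defS dxVW] := redS V modV sVS.
have sWS : (W <= specht_space F la L)%MS by rewrite -defS addsmxSr.
have line m (X : 'M_(m, _)) : mxmodule (rep la) X -> (X <= specht_space F la L)%MS ->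
    forall x, (x <= X)%MS -> exists2 a, x *m kappa t la = a *: polytabloid F t id
      & a != 0 -> (specht_space F la L <= X)%MS.
  move=> modX sXS x xX; have: (x *m kappa t la <= polytabloid F t id)%MS.
    exact: submx_trans (submxMr _ (submx_trans xX sXS)) specht_kappa.
  case/sub_rVP => a xa; exists a => // nza; apply: (specht_sub modX).
  rewrite -[polytabloid _ _ _](scalerK nza) -xa scalemx_sub //.
  exact: submx_trans (submxMr _ xX) (kappa_module modX).
have: (polytabloid F t id <= V + W)%MS by rewrite defS polytabloid_sub.
case/sub_addsmxP => -[x y] /= txy.
have [a xa aV] := line _ _ modV sVS (x *m V) (submxMl _ _).
have [c yc cW] := line _ _ modW sWS (y *m W) (submxMl _ _).
have := polytabloid_kappa_mul; rewrite {1}txy mulmxDl xa yc -scalerDl => /eqP.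
rewrite -subr_eq0 -scalerBl scaler_eq0 (negPf polytabloid_neq0) orbF subr_eq0.
have [-> | /aV //] := eqVneq a 0; rewrite add0r => /eqP cE.
have sSW : (specht_space F la L <= W)%MS by apply: cW; rewrite cE col_stab_neq0.
move/mxdirect_addsP: dxVW => VW0; case/negP: nzV.
by rewrite -submx0 -VW0 sub_capmx submx_refl (submx_trans sVS).
Qed.

Let trace_kappa mu p (pr := pinvmx (specht_space F mu L) *m specht_space F mu L) :
  \tr (specht F mu L p) = \tr (pr *m rep mu p).
Proof.
apply: trace_submod_proj; rewrite ?inE ?submxMl //.
by rewrite mulmxA mulmxKpV.
Qed.

(** Up to the factor [#|col_stab t|], the multiplicity of the sign character in the Specht module
    restricted to the column stabilizer. Being expressed by traces, it is invariant under
    isomorphism. *)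
Let sgn_trace mu := \sum_(p in col_stab t) (-1) ^+ odd_perm p * \tr (specht F mu L p).

Let sgn_traceE mu (pr := pinvmx (specht_space F mu L) *m specht_space F mu L) :
  sgn_trace mu = \tr (pr *m kappa t mu).
Proof.
rewrite mulmx_sumr raddf_sum; apply: eq_bigr => p _.
by rewrite trace_kappa -mxtraceZ scalemxAr.
Qed.

(** After projection, [kappa] has image in the line of the polytabloid of [t], on which it acts by
    [#|col_stab t|]. *)
Lemma sgn_trace_own : sgn_trace la != 0.
Proof.
rewrite sgn_traceE; set pr := pinvmx _ *m _.
have: (pr *m kappa t la <= polytabloid F t id)%MS.
  by rewrite /pr -mulmxA; apply: submx_trans (submxMl _ _) specht_kappa.
case/submxP => y E.
have epr : polytabloid F t id *m pr = polytabloid F t id.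
  by rewrite mulmxA mulmxKpV // polytabloid_sub.
have := polytabloid_kappa_mul; rewrite -{1}epr -mulmxA E mulmxA => /eqP.
rewrite [_ *m y]mx11_scalar mul_scalar_mx -subr_eq0 -scalerBl scaler_eq0.
rewrite (negPf polytabloid_neq0) orbF subr_eq0 => /eqP ey.
by rewrite mxtrace_mulC [_ *m y]mx11_scalar mxtrace_scalar ey col_stab_neq0.
Qed.

Lemma sgn_trace_nz mu : sgn_trace mu != 0 ->
  exists2 s : cell la -> cell mu, bijective s &
    forall c d : cell la, col_of c = col_of d -> row_of (s c) = row_of (s d) -> c = d.
Proof.
rewrite sgn_traceE => nz.
have [/existsP[t' /andP[tab_t' nz']] | no] :=
    boolP [exists t' : {ffun cell mu -> L}, is_tableau t' &&
       (bvec F (tabloid t') *m kappa t mu != 0)].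
  have [s' t's' s't'] := tableau_inv tab_t'; have [s ts st] := tableau_inv tab_t.
  exists (s' \o t); last exact: kappa_nz_inj nz'.
  by exists (s \o t') => c /=; rewrite ?s't' ?t's' ?ts ?st ?t's'.
case/negP: nz; rewrite -mulmxA (_ : _ *m kappa t mu = 0) ?mulmx0 ?mxtrace0 //.
apply/eqP; rewrite -submx0 sumsmxMr; apply/sumsmx_subP => t' tab_t'.
rewrite (eqmxMr _ (genmxE _)) mulmx_suml; apply: summx_sub => p _.
rewrite -scalemxAl scalemx_sub // submx0; apply: contraNT no => nz'.
by apply/existsP; exists [ffun c => id (p (t' c))]; rewrite tableau_comp.
Qed.

End OneTableau.

Lemma specht_irr la (t : {ffun cell la -> L}) : is_tableau t ->
  mx_irreducible (specht F la L).
Proof. by move=> tab_t; apply/submod_mx_irr; apply: specht_simple tab_t. Qed.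

(** Equal traces make both mixed sign multiplicities nonzero. The bijections obtained in the two
    directions give both inequalities of row sums, and equality forces equal diagrams. *)
Lemma specht_rsim la mu (t : {ffun cell la -> L}) (t' : {ffun cell mu -> L}) :
    is_tableau t -> is_tableau t' ->
  mx_rsim (specht F la L) (specht F mu L) -> la = mu.
Proof.
move=> tab_t tab_t' sim.
have tr p : \tr (specht F la L p) = \tr (specht F mu L p).
  by apply: mxtrace_rsim sim _ _; rewrite inE.
have nz := sgn_trace_own tab_t; have nz' := sgn_trace_own tab_t'.
have [|s bij_s inj_s] := sgn_trace_nz tab_t (mu := mu).
  by rewrite /=; under eq_bigr => p _ do rewrite -tr.
have [|s' bij_s' inj_s'] := sgn_trace_nz tab_t' (mu := la).
  by rewrite /=; under eq_bigr => p _ do rewrite tr.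
exact: row_sum_eq_part bij_s inj_s (row_sum_leq bij_s' inj_s').
Qed.
End Kappa.

(** * Second orthogonality *)

Lemma card_conj_eq (gT : finGroupType) (x p : gT) :
  #|[set q | (x ^ q == x ^ p)%g]| = #|'C[x]%g|.
Proof.
rewrite -(card_rcoset 'C[x] p); apply: eq_card => q; rewrite inE mem_rcoset.
have conj_mul : (x ^ q == x ^ p)%g = (x ^ (q * p^-1) == x)%g.
  by rewrite conjgM -[RHS](inj_eq (conjg_inj p)) conjgKV.
rewrite conj_mul; set r := (q * p^-1)%g; apply/eqP/cent1P => [xr | com].
  by rewrite /commute (conjgC x r) xr.
by apply: (mulgI r); rewrite -conjgC.
Qed.

Lemma card_class_conj (gT : finGroupType) (x y : gT) :
  (#|x ^: [set: gT]| * #|[set p | (x ^ p == y)%g]| =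
   #|[set: gT]| * (y \in x ^: [set: gT]))%N.
Proof.
have [/imsetP[p _ ->] | ny] := boolP (y \in _).
  rewrite card_conj_eq muln1 -index_cent1 mulnC.
  by rewrite setTI Lagrange ?subsetT.
rewrite muln0 [X in (_ * X)%N]eq_card0 ?muln0 // => p; rewrite inE.
by apply: contraNF ny => /eqP <-; rewrite memJ_class // inE.
Qed.

(** The product being the identity already bounds [m] by [n], so the matrices are square. *)
Lemma mulmx1_square (F : fieldType) m n (A : 'M[F]_(m, n)) (B : 'M[F]_(n, m)) :
  (n <= m)%N -> A *m B = 1%:M -> B *m A = 1%:M.
Proof.
move=> le AB; have ge := mulmx1_min AB.
have nm : n = m by apply/eqP; rewrite eqn_leq le.
by move: A B AB; rewrite nm => A B AB; apply: mulmx1C.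
Qed.

Section SecondOrthogonality.

Variables (F : numClosedFieldType) (gT : finGroupType) (I : finType).
Variable chi : I -> gT -> F.
Local Notation G := [set: gT]%G.
Local Notation N := (#|[set: gT]|%:R : F).

Hypothesis chiJ : forall i x p, chi i (x ^ p)%g = chi i x.
Hypothesis chi_orth : forall i j,
  \sum_(x in [set: gT]) chi i x * chi j x^-1%g = N *+ (i == j).
Hypothesis card_classes_leq : (#|classes G| <= #|I|)%N.

Let nzN : N != 0.
Proof. exact: (natr_card_neq0 F G). Qed.

Let chi_repr i C z : C \in classes G -> z \in C -> chi i (repr C) = chi i z.
Proof.
case/imsetP => v _ -> /imsetP[p _ ->]; have [q _ ->] := repr_class G v.
by rewrite !chiJ.
Qed.

(* The square matrix of values on class representatives has a right inverse by
   the first orthogonality relation, hence a left one. *)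
Lemma second_orthogonality x y :
  \sum_i chi i x * chi i y = #|[set p | (x ^ p == y^-1)%g]|%:R.
Proof.
pose cls (j : 'I_#|classes G|) := enum_val j.
pose X := \matrix_(i < #|I|, j < #|classes G|) chi (enum_val i) (repr (cls j)).
(* Grouped by conjugacy classes, the first orthogonality relation reads [X *m Y = 1%:M]. *)
pose Y := \matrix_(j < #|classes G|, i < #|I|)
   (N^-1 * \sum_(z in cls j) chi (enum_val i) z^-1%g).
have XY : X *m Y = 1%:M.
  apply/matrixP => i k; rewrite !mxE.
  transitivity (N^-1 * \sum_(z in G) chi (enum_val i) z * chi (enum_val k) z^-1%g).
    rewrite (set_partition_big _ (classes_partition G)) big_enum_val mulr_sumr.
    apply: eq_bigr => j _; rewrite !mxE mulrCA; congr (_ * _); rewrite mulr_sumr.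
    by apply: eq_bigr => z zj; rewrite (chi_repr _ (enum_valP j) zj).
  by rewrite chi_orth mulrnAr mulVf // (inj_eq enum_val_inj).
have YX := mulmx1_square card_classes_leq XY.
(* [Y] evaluates characters at inverses, so its row at the class of [x^-1] produces the values
   [chi i x]. *)
have [Cx Cy] := (mem_classes (in_setT x^-1%g), mem_classes (in_setT y)).
pose j := enum_rank_in Cx (x^-1 ^: G)%g; pose l := enum_rank_in Cx (y ^: G)%g.
have clsj : cls j = (x^-1 ^: G)%g by rewrite /cls enum_rankK_in.
have clsl : cls l = (y ^: G)%g by rewrite /cls enum_rankK_in.
have C_neq0 : #|cls j|%:R != 0 :> F.
  rewrite clsj Num.Theory.pnatr_eq0 -lt0n card_gt0; apply/set0Pn; exists x^-1%g.
  exact: class_refl.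
have /matrixP/(_ j l) := YX; rewrite !mxE.
have -> : \sum_i Y j i * X i l = N^-1 * (#|cls j|%:R * \sum_i chi i x * chi i y).
  rewrite !mulr_sumr [RHS](reindex_onto enum_val enum_rank) /=;
    last by move=> i _; apply: enum_rankK.
  rewrite [RHS](eq_bigl xpredT) => [|i]; last by rewrite enum_valK eqxx.
  apply: eq_bigr => i _; rewrite !mxE clsl (chi_repr _ Cy (class_refl _ _)).
  rewrite -mulrA; congr (_ * _); rewrite [RHS]mulrA; congr (_ * _).
  rewrite mulr_natl -sumr_const.
  apply: eq_bigr => z; rewrite clsj => /imsetP[p _ ->].
  by rewrite -conjVg invgK chiJ.
have jl : (j == l) = (y \in x^-1 ^: G)%g.
  rewrite -(inj_eq enum_val_inj) -/(cls j) -/(cls l) clsj clsl.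
  by rewrite eq_sym; apply/eqP/idP => [<- | /class_eqP //]; apply: class_refl.
rewrite jl => S; apply: (mulfI C_neq0); apply: (mulfI (invr_neq0 nzN)); rewrite {}S.
have -> : #|[set p | (x ^ p == y^-1)%g]| = #|[set p | (x^-1 ^ p == y)%g]|.
  by apply: eq_card => p; rewrite !inE -(inj_eq invg_inj) invgK conjVg.
by rewrite -natrM clsj card_class_conj natrM mulKf.
Qed.

Variable c : I -> I -> I -> nat.
Hypothesis cE : forall i j k,
  \sum_(x in [set: gT]) chi i x * chi j x * chi k x^-1%g = (#|[set: gT]| * c i j k)%:R.

Lemma tensor_coef_sum k x y :
  \sum_i \sum_j chi i x * chi j y *+ c i j k =
  chi k y *+ #|[set p | (y ^ p == x)%g]|.
Proof.
apply: (mulfI nzN).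
(* By [cE] each coefficient is a sum over [v]; once this sum is outermost, those over [i] and [j]
   separate. *)
transitivity (\sum_(v in [set: gT]) chi k v^-1%g *
    ((\sum_i chi i v * chi i x) * (\sum_j chi j v * chi j y))).
  rewrite mulr_sumr; under eq_bigr => i _.
    rewrite mulr_sumr; under eq_bigr => j _.
      rewrite -[_ *+ c _ _ _]mulr_natr mulrCA -natrM -cE mulr_sumr; over.
    rewrite exchange_big; over.
  rewrite exchange_big /=; apply: eq_bigr => v _.
  rewrite mulr_suml mulr_sumr; apply: eq_bigr => i _.
  rewrite !mulr_sumr; apply: eq_bigr => j _.
  by ring.
rewrite (eq_bigl xpredT) => [|v]; last by rewrite inE.
transitivity (\sum_(v : gT) \sum_(q : gT | (v ^ q == y^-1)%g)
    chi k v^-1%g * #|[set p | (v ^ p == x^-1)%g]|%:R).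
  apply: eq_bigr => v _; rewrite !second_orthogonality mulrA.
  by rewrite sumr_const mulr_natr; congr (_ *+ _); rewrite cardsE.
rewrite (exchange_big_dep xpredT) //=.
rewrite (eq_bigr (fun=> chi k y *+ #|[set p | (y ^ p == x)%g]|)) => [|q _].
  by rewrite sumr_const cardsT mulr_natl.
(* Each [q] determines one [v], and the remaining term is independent of [q]; summing over [q]
   supplies the factor [N]. *)
rewrite (big_pred1 (y^-1 ^ q^-1)%g) => [|v]; last first.
  by rewrite /= -[RHS](inj_eq (conjg_inj q)) conjgKV.
rewrite -conjVg invgK chiJ mulr_natr; congr (_ *+ _).
rewrite -[RHS](card_preimset _ (mulgI q^-1%g)); apply: eq_card => p.
by rewrite !inE -conjgM conjVg (inj_eq invg_inj).
Qed.

(** In the application [z] is 1/b! and [M w] counts the ordered partitions of the remaining letters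
    on which a given permutation acts as [w], so that the inner sum becomes a Foulkes trace. *)
Lemma tensor_coef_convolution k x (z : F) (M : gT -> nat) :
  z * (\sum_w chi k w *+ (#|[set p | (w ^ p == x)%g]| * M w)) =
  \sum_i \sum_j (chi i x * (z * \sum_w chi j w *+ M w)) *+ c i j k.
Proof.
transitivity (z * \sum_w (\sum_i \sum_j chi i x * chi j w *+ c i j k) *+ M w).
  by congr (_ * _); apply: eq_bigr => w _; rewrite tensor_coef_sum mulrnA.
rewrite mulr_sumr; under eq_bigr => w _.
  rewrite -sumrMnl mulr_sumr; under eq_bigr => i _.
    rewrite -sumrMnl mulr_sumr; over.
  over.
rewrite exchange_big; apply: eq_bigr => i _.
rewrite exchange_big; apply: eq_bigr => j _.
rewrite mulr_sumr mulr_sumr -sumrMnl; apply: eq_bigr => w _.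
by rewrite !mulrnAr mulrnAC mulrCA.
Qed.

End SecondOrthogonality.

(** Every [p] accounts for exactly one [w], a conjugate of [x]. *)
Lemma class_fun_conj_sum (R : nmodType) (gT : finGroupType) (f : gT -> R) x :
    (forall y p, f (y ^ p)%g = f y) ->
  \sum_w f w *+ #|[set p | (w ^ p == x)%g]| = f x *+ #|[set: gT]|.
Proof.
move=> fJ; transitivity (\sum_w \sum_(p | (w ^ p == x)%g) f w).
  by apply: eq_bigr => w _; rewrite sumr_const; congr (_ *+ _); rewrite cardsE.
rewrite (exchange_big_dep xpredT) //= cardsT -sumr_const; apply: eq_bigr => p _.
rewrite (big_pred1 (x ^ p^-1)%g) ?fJ // => w.
by rewrite /= -[RHS](inj_eq (conjg_inj p)) conjgKV.
Qed.

(** * Blocks meeting the first b letters once *)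

Section Blocks.

Variables b n : nat.
Hypothesis hk : (b <= n)%N.
Local Notation e := (subnKC hk).
Local Notation m := (n - b)%N.

Definition letl (i : 'I_b) : 'I_n := cast_ord e (lshift m i).
Definition letr (j : 'I_m) : 'I_n := cast_ord e (rshift b j).

Lemma letP z : (exists i, z = letl i) \/ (exists j, z = letr j).
Proof.
rewrite -(cast_ordKV e z); case: (split_ordP (cast_ord (esym e) z)) => k ->.
  by left; exists k.
by right; exists k.
Qed.

Lemma letl_inj : injective letl.
Proof. by move=> i j /cast_ord_inj/lshift_inj. Qed.

Lemma letr_inj : injective letr.
Proof. by move=> i j /cast_ord_inj/rshift_inj. Qed.

Lemma letlr i j : (letl i == letr j) = false.
Proof. by rewrite /letl /letr (inj_eq (@cast_ord_inj _ _ _)) eq_lrshift. Qed.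

Lemma young_letl g i : young_embed hk g (letl i) = letl (g.1 i).
Proof.
by rewrite /young_embed cast_permE cast_ordK permE /young_fun (unsplitK (inl _)).
Qed.

Lemma young_letr g j : young_embed hk g (letr j) = letr (g.2 j).
Proof.
by rewrite /young_embed cast_permE cast_ordK permE /young_fun (unsplitK (inr _)).
Qed.

Definition glue (p : 'S_b) (Y : {ffun 'I_b -> {set 'I_m}}) :
    {ffun 'I_b -> {set 'I_n}} :=
  [ffun i => letl (p i) |: (letr @: Y i)].

Lemma letl_glue p Y i k : (letl k \in glue p Y i) = (k == p i).
Proof.
rewrite ffunE !inE (inj_eq letl_inj) orbC; case: imsetP => // -[j _ /eqP].
by rewrite letlr.
Qed.

Lemma letr_glue p Y i k : (letr k \in glue p Y i) = (k \in Y i).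
Proof. by rewrite ffunE !inE eq_sym letlr mem_imset //; apply: letr_inj. Qed.

Lemma set_letP (A B : {set 'I_n}) :
  (forall i, (letl i \in A) = (letl i \in B)) ->
  (forall j, (letr j \in A) = (letr j \in B)) -> A = B.
Proof. by move=> l r; apply/setP => z; case: (letP z) => -[k ->]. Qed.

Lemma glue_inj p Y p' Y' : glue p Y = glue p' Y' -> (p, Y) = (p', Y').
Proof.
move/ffunP => E; congr (_, _).
  apply/permP => i; have := letl_glue p Y i (p i).
  by rewrite E letl_glue eqxx => /eqP.
apply/ffunP => i; apply/setP => k.
by rewrite -(letr_glue p) E letr_glue.
Qed.

Lemma move_glue g p Y :
  move_blocks (young_embed hk g) (glue p Y) = glue (p * g.1)%g (move_blocks g.2 Y).
Proof.
apply/ffunP => i; rewrite ffunE [RHS]ffunE ffunE imsetU1 young_letl permM.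
congr (_ |: _); rewrite ffunE -!imset_comp.
by apply: eq_imset => j /=; rewrite young_letr.
Qed.

Lemma glue_perm p Y (w : 'S_b) :
  [ffun i => glue p Y (w i)] = glue (w * p)%g [ffun i => Y (w i)].
Proof. by apply/ffunP => i; rewrite !ffunE permM. Qed.

Lemma glue_opart a p Y : (0 < a)%N -> is_opart a (glue p Y) = is_opart a.-1 Y.
Proof.
move=> a_gt0; rewrite /is_opart; congr [&& _, _ & _].
- apply: eq_forallb => i; rewrite ffunE cardsU1 card_imset; last exact: letr_inj.
  rewrite (_ : _ \notin _); last by apply/imsetP => -[j _ /eqP]; rewrite letlr.
  by rewrite -[in LHS](prednK a_gt0).
- apply: eq_forallb => i; apply: eq_forallb => j; case: eqVneq => //= nij.
  apply/pred0P/pred0P => D => [k | z]; rewrite /= ?inE.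
    by have := D (letr k); rewrite /= !letr_glue.
  case: (letP z) => -[k ->]; last by rewrite !letr_glue; exact: D.
  rewrite !letl_glue; apply/andP => -[/eqP-> /eqP/perm_inj ij].
  by rewrite ij eqxx in nij.
apply/eqP/eqP => /setP cov; apply/setP => z; rewrite inE; apply/bigcupP.
  have := cov (letr z); rewrite inE => /bigcupP[i _]; rewrite letr_glue.
  by exists i.
case: (letP z) => -[k ->].
  by exists (p^-1%g k); rewrite // letl_glue permKV.
have := cov k; rewrite inE => /bigcupP[i _ ki].
by exists i; rewrite // letr_glue.
Qed.

(** There are [b] blocks, so [b] entries surviving the filter mean that nothing was discarded. *)
Lemma block_type_ones (X : {ffun 'I_b -> {set 'I_n}}) :
  (block_type b X == nseq b 1%N) =
  [forall i, #|X i :&: [set x : 'I_n | (x < b)%N]| == 1%N].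
Proof.
rewrite /block_type; set f := fun i : 'I_b => #|_ :&: _|.
have sz : size [seq f i | i : 'I_b] = b by rewrite size_map -cardE card_ord.
apply/eqP/forallP => [E i | E].
  have all1 : all (pred1 1%N) [seq k <- [seq f i | i : 'I_b] | k != 0%N].
    by rewrite -(all_sort _ geq) E all_pred1_nseq.
  have alln0 : all (fun k => k != 0%N) [seq f i | i : 'I_b].
    by rewrite all_count -size_filter -(size_sort geq) E size_nseq sz.
  rewrite (all_filterP alln0) in all1.
  by move/allP: all1 => /(_ (f i)); apply; apply: map_f; rewrite mem_enum.
have all1 : all (pred1 1%N) [seq f i | i : 'I_b].
  by apply/allP => _ /mapP[i _ ->]; apply: E.
have fs : [seq k <- [seq f i | i : 'I_b] | k != 0%N] = [seq f i | i : 'I_b].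
  by apply/all_filterP; apply: sub_all all1 => k /eqP ->.
have: all (pred1 1%N) (sort geq [seq f i | i : 'I_b]) by rewrite all_sort.
by move/all_pred1P; rewrite size_sort sz fs.
Qed.

Lemma glue_block_type p Y : block_type b (glue p Y) == nseq b 1%N.
Proof.
rewrite block_type_ones; apply/forallP => i.
rewrite (_ : _ :&: _ = [set letl (p i)]) ?cards1 //.
apply: set_letP => k; rewrite !inE.
  by rewrite letl_glue (inj_eq letl_inj) /= ltn_ord andbT.
by rewrite /= ltnNge leq_addr andbF eq_sym letlr.
Qed.

(** Each block selects one of the first [b] letters; disjointness makes the selection injective,
    hence a permutation. *)
Lemma glue_surj a (X : {ffun 'I_b -> {set 'I_n}}) :
  is_opart a X -> block_type b X == nseq b 1%N -> exists p Y, X = glue p Y.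
Proof.
case/and3P => _ /forallP disX _; rewrite block_type_ones => /forallP one.
have ex i : exists k, letl k \in X i.
  have /cards1P[z zE] := one i.
  have: z \in X i :&: [set x : 'I_n | (x < b)%N] by rewrite zE set11.
  rewrite inE => /andP[zX]; case: (letP z) zX => -[k ->] kX; first by exists k.
  by rewrite inE /= ltnNge leq_addr.
pose f i := xchoose (ex i); have fP i : letl (f i) \in X i := xchooseP (ex i).
have uniq_f i k : letl k \in X i -> k = f i.
  have /cards1P[z zE] := one i => kX; apply: letl_inj.
  have inz j : letl j \in X i -> letl j = z.
    by move=> jX; apply/set1P; rewrite -zE !inE jX /= ltn_ord.
  by rewrite (inz k) // (inz (f i)).
have injf : injective f.
  move=> i j fij; apply/eqP; apply: contraT => nij.
  have /forallP/(_ j)/implyP/(_ nij)/pred0P/(_ (letl (f i))) := disX i.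
  by rewrite /= fP fij fP.
exists (perm injf), [ffun i => letr @^-1: X i]; apply/ffunP => i.
apply: set_letP => k; last by rewrite letr_glue ffunE inE.
by rewrite letl_glue permE; apply/idP/eqP => [/uniq_f // | ->].
Qed.

Lemma card_glue a (g : 'S_b * 'S_m) (w : 'S_b) : (0 < a)%N ->
  #|[set X : {ffun 'I_b -> {set 'I_n}} |
      is_opart a X && (block_type b X == nseq b 1%N) &&
      (move_blocks (young_embed hk g) X == [ffun i => X (w i)])]| =
  (#|[set p : 'S_b | (w ^ p == g.1)%g]| *
   #|[set Y : {ffun 'I_b -> {set 'I_m}} |
       is_opart a.-1 Y && (move_blocks g.2 Y == [ffun i => Y (w i)])]|)%N.
Proof.
move=> a_gt0; rewrite -cardsX -(card_imset (f := fun x => glue x.1 x.2)); last first.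
  by move=> [p Y] [p' Y'] /glue_inj.
(* Comparing the first [b] letters gives [p * g.1 = w * p], a conjugacy equation; the other letters
   give the condition on [Y]. *)
have eq_glue p Y : (move_blocks (young_embed hk g) (glue p Y) ==
    [ffun i => glue p Y (w i)]) =
    (w ^ p == g.1)%g && (move_blocks g.2 Y == [ffun i => Y (w i)]).
  rewrite move_glue glue_perm; apply/eqP/andP => [/glue_inj[pE ->] | [/eqP <- /eqP ->]].
    by split=> //; rewrite conjgE -pE mulKg.
  by rewrite -conjgC.
apply: eq_card => X; rewrite inE; apply/idP/imsetP => [|[[p Y] pY ->]].
  case/andP => /andP[Xa Xb] Xw; have [p [Y XE]] := glue_surj Xa Xb.
  exists (p, Y) => //; move: Xa Xw; rewrite XE glue_opart // eq_glue !inE /=.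
  by move=> -> /andP[-> ->].
move: pY; rewrite !inE /= => /andP[pE /andP[Ya YE]].
by rewrite glue_opart // Ya glue_block_type eq_glue pE YE.
Qed.

End Blocks.

(** * Traces of Foulkes modules *)

Lemma opart_inj a b n (X : {ffun 'I_b -> {set 'I_n}}) : (0 < a)%N ->
  is_opart a X -> injective X.
Proof.
move=> a_gt0 /and3P[/forallP cX /forallP dX _] i j Xij.
apply/eqP; apply: contraT => nij.
have /forallP/(_ j)/implyP/(_ nij) := dX i.
rewrite -setI_eq0 Xij setIid -cards_eq0 (eqP (cX j)).
by rewrite (gtn_eqF a_gt0).
Qed.

Lemma opart_perm a b n (X : {ffun 'I_b -> {set 'I_n}}) (w : 'S_b) :
  is_opart a X -> is_opart a [ffun i => X (w i)].
Proof.
case/and3P => /forallP cX /forallP dX /eqP covX; apply/and3P; split.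
- by apply/forallP => i; rewrite ffunE.
- apply/forallP => i; apply/forallP => j; rewrite !ffunE -(inj_eq (@perm_inj _ w)).
  by have /forallP := dX (w i); apply.
apply/eqP; rewrite -covX [RHS](reindex_inj (@perm_inj _ w)).
by apply: eq_bigr => i _; rewrite ffunE.
Qed.

Lemma block_type_perm b n k (X : {ffun 'I_b -> {set 'I_n}}) (w : 'S_b) :
  block_type k [ffun i => X (w i)] = block_type k X.
Proof.
have tot : total geq by move=> x y; rewrite /= orbC leq_total.
have trans : transitive geq by move=> x y z /= xy yz; apply: leq_trans yz xy.
have anti : antisymmetric geq.
  by move=> x y /andP[/= xy yx]; apply/eqP; rewrite eqn_leq xy yx.
apply/(perm_sortP tot trans anti)/perm_filter.
pose f i := #|X i :&: [set x : 'I_n | (x < k)%N]|.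
have E : map (fun i => #|[ffun j => X (w j)] i :&: [set x : 'I_n | (x < k)%N]|)
    (enum 'I_b) = map (f \o w) (enum 'I_b) by apply: eq_map => i; rewrite ffunE.
rewrite /image_mem E.
rewrite (map_comp f w) perm_map // uniq_perm ?enum_uniq //.
  by rewrite map_inj_uniq ?enum_uniq //; apply: perm_inj.
move=> l; rewrite mem_enum inE -[l](permKV w).
by rewrite map_f ?mem_enum.
Qed.

(** Ordered partitions into singletons are permutations; moving letters by [h] becomes right
    multiplication by [h], and permuting blocks by [w] left multiplication by [w]. *)
Lemma card_opart1 b (h w : 'S_b) :
  #|[set Y : {ffun 'I_b -> {set 'I_b}} |
      is_opart 1 Y && (move_blocks h Y == [ffun i => Y (w i)])]| =
  #|[set p : 'S_b | (w ^ p == h)%g]|.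
Proof.
pose sing (p : 'S_b) := [ffun i => [set p i]] : {ffun 'I_b -> {set 'I_b}}.
have sing_inj : injective sing.
  move=> p q /ffunP pq; apply/permP => i.
  by have := pq i; rewrite !ffunE => /set1_inj.
have sing_opart p : is_opart 1 (sing p).
  apply/and3P; split.
  - by apply/forallP => i; rewrite ffunE cards1.
  - apply/forallP => i; apply/forallP => j; apply/implyP => nij.
    by rewrite !ffunE disjoints1 inE (inj_eq perm_inj).
  apply/eqP/setP => z; rewrite inE; apply/bigcupP.
  by exists (p^-1%g z); rewrite // ffunE permKV set11.
have sing_move p :
      (move_blocks h (sing p) == [ffun i => sing p (w i)]) = (w ^ p == h)%g.
  have -> : move_blocks h (sing p) = sing (p * h)%g.
    by apply/ffunP => i; rewrite !ffunE imset_set1 permM.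
  have -> : [ffun i => sing p (w i)] = sing (w * p)%g.
    by apply/ffunP => i; rewrite !ffunE permM.
  by rewrite (inj_eq sing_inj) (conjgC w p) (inj_eq (mulgI p)) eq_sym.
rewrite -(card_imset _ sing_inj); apply: eq_card => Y.
rewrite inE; apply/andP/imsetP => [[Y1] | [p]]; last first.
  by rewrite inE => ph ->; rewrite sing_move.
have /forallP cY := proj1 (andP Y1).
have ex i : exists z, Y i == [set z] by have /cards1P[z ->] := cY i; exists z.
pose f i := xchoose (ex i); have fP i : Y i = [set f i] := eqP (xchooseP (ex i)).
have injf : injective f.
  by move=> i j fij; apply: (opart_inj _ Y1); rewrite // !fP fij.
have YE : Y = sing (perm injf) by apply/ffunP => i; rewrite ffunE permE fP.
by rewrite YE sing_move => ph; exists (perm injf); rewrite ?inE.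
Qed.

(** * Specht characters and Kronecker coefficients *)

Section SpechtCharacters.

Variables (F : numClosedFieldType) (b : nat).
Implicit Types mu la nu : intpart b.

Let chi mu (p : 'S_b) := \tr (specht F mu 'I_b p).

Lemma specht_class mu x p : chi mu (x ^ p)%g = chi mu x.
Proof.
rewrite /chi conjgE !repr_mxM ?inE // mxtrace_mulC -mulmxA -repr_mxM ?inE //.
by rewrite mulgV repr_mx1 mulmx1.
Qed.

Lemma specht_first_orthogonality mu la :
  \sum_(x in [set: 'S_b]) chi mu x * chi la x^-1%g = #|[set: 'S_b]|%:R *+ (mu == la).
Proof.
have [[t tab_t] [t' tab_t']] := (tableau_exists mu, tableau_exists la).
have irr_mu := specht_irr F tab_t; have irr_la := specht_irr F tab_t'.
have [<- | nml] := eqVneq.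
  exact: orthogonality_rsim irr_mu (mx_rsim_refl _).
apply: orthogonality_not_rsim irr_mu irr_la _ => sim.
by case/eqP: nml; apply: specht_rsim tab_t tab_t' sim.
Qed.

Lemma kronecker_trace mu la nu :
  \sum_(x in [set: 'S_b]) chi mu x * chi la x * chi nu x^-1%g =
  (#|[set: 'S_b]| * kronecker F mu la nu)%:R.
Proof.
have [t tab_t] := tableau_exists nu.
rewrite /kronecker -multiplicity_trace; last exact: specht_irr tab_t.
by apply: eq_bigr => x _; rewrite /chi -mxtrace_prod.
Qed.

Lemma kronecker_convolution nu x (z : F) (M : 'S_b -> nat) :
  z * (\sum_w chi nu w *+ (#|[set p | (w ^ p == x)%g]| * M w)) =
  \sum_mu \sum_la (chi mu x * (z * \sum_w chi la w *+ M w)) *+ kronecker F mu la nu.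
Proof.
exact: (tensor_coef_convolution specht_class specht_first_orthogonality
  (card_classes_Sym_leq b) kronecker_trace).
Qed.

End SpechtCharacters.

Section FoulkesTraces.

Variables (F : numClosedFieldType) (b : nat) (nu : intpart b).
Variable t : {ffun cell nu -> 'I_b}.
Hypothesis tab_t : is_tableau t.

Lemma trace_foulkes a n (h : 'S_n) : (0 < a)%N ->
  \tr (foulkes F t a n h) = #|{perm 'I_b}|%:R^-1 *
    \sum_(w : 'S_b) \tr (specht F nu 'I_b w) *+
      #|[set Y : {ffun 'I_b -> {set 'I_n}} |
          is_opart a Y && (move_blocks h Y == [ffun i => Y (w i)])]|.
Proof.
move=> a_gt0.
by apply: (trace_span (P := @is_opart a b n) tab_t _ _ (foulkes_module F t a n)
  (h := h) (to := 'P%act^*)) => [X | X w | | ];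
  [exact: opart_inj | exact: opart_perm | rewrite inE | ].
Qed.

Lemma trace_component a n k (hk : (k <= n)%N) lambda (g : 'S_k * 'S_(n - k)) :
    (0 < a)%N ->
  \tr (component F t a hk lambda g) = #|{perm 'I_b}|%:R^-1 *
    \sum_(w : 'S_b) \tr (specht F nu 'I_b w) *+
      #|[set X : {ffun 'I_b -> {set 'I_n}} |
          is_opart a X && (block_type k X == lambda) &&
          (move_blocks (young_embed hk g) X == [ffun i => X (w i)])]|.
Proof.
move=> a_gt0.
apply: (trace_span (P := fun X => is_opart a X && (block_type k X == lambda)) tab_t _ _
  (component_module F t a hk lambda)
  (h := young_embed hk g) (to := 'P%act^*)) => [X | X w | | ].
- by case/andP => /(opart_inj a_gt0).
- by case/andP => Xa Xl; rewrite opart_perm //= block_type_perm.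
- by rewrite inE.
by [].
Qed.

(** For blocks of size one the counts are numbers of conjugating elements, and averaging a class
    function against them returns it. The equation [n = b] is a hypothesis because the application
    has [n = 2 * b - b]. *)
Lemma trace_foulkes1 n (h : 'S_n) : n = b ->
  \tr (foulkes F t 1 n h) = \tr (specht F nu 'I_n h).
Proof.
move=> nb; move: h; rewrite nb => h; rewrite trace_foulkes //.
have nzN := natr_card_neq0 F [set: {perm 'I_b}]%G.
rewrite -cardsT; apply: (mulfI nzN); rewrite mulVKf //.
under eq_bigr => w _ do rewrite card_opart1.
rewrite [RHS]mulr_natl.
exact: (class_fun_conj_sum (f := fun w => \tr (specht F nu 'I_b w)) h
  (@specht_class F b nu)).
Qed.

End FoulkesTraces.

Theorem theorem1 (R : realType) (a b : nat) (ha : (1 < a)%N) (hb : (1 < b)%N)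
    (nu : intpart b) (t : {ffun cell nu -> 'I_b}) (ht : is_tableau t)
    (u : forall la : intpart b, {ffun cell la -> 'I_b})
    (hu : forall la : intpart b, is_tableau (u la)) :
  mx_rsim (foulkesU R[i] ha t)
    (\big[dadd_grepr/grepr0]_(mu : intpart b) \big[dadd_grepr/grepr0]_(la : intpart b)
       muln_grepr
         (outer_repr (specht R[i] mu 'I_b) (foulkes R[i] (u la) a.-1 (a * b - b)%N))
         (kronecker R[i] mu la nu))
  /\
  (a = 2%N ->
   mx_rsim (foulkesU R[i] ha t)
     (\big[dadd_grepr/grepr0]_(mu : intpart b) \big[dadd_grepr/grepr0]_(la : intpart b)
        muln_grepr
          (outer_repr (specht R[i] mu 'I_b) (specht R[i] la 'I_(a * b - b)))
          (kronecker R[i] mu la nu))).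
Proof.
have a_gt0 : (0 < a)%N := ltnW ha.
have a1_gt0 : (0 < a.-1)%N by rewrite -ltnS prednK.
(* Only the traces of the second factors matter, so both claims are instances: [V] is the Foulkes
   family or, for [a = 2], the Specht family on the remaining letters. *)
have trU (V : intpart b -> representation R[i] [set: 'S_(a * b - b)]) :
    (forall la h, \tr (V la h) = \tr (foulkes R[i] (u la) a.-1 (a * b - b)%N h)) ->
  mx_rsim (foulkesU R[i] ha t)
    (\big[dadd_grepr/grepr0]_(mu : intpart b) \big[dadd_grepr/grepr0]_(la : intpart b)
       muln_grepr (outer_repr (specht R[i] mu 'I_b) (V la)) (kronecker R[i] mu la nu)).
  move=> trV; apply: rsim_of_trace => g _.
  rewrite trace_component //.
  under eq_bigr => w _ do rewrite (card_glue _ _ _ a_gt0).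
  rewrite kronecker_convolution mxtrace_dsum; apply: eq_bigr => mu _.
  rewrite mxtrace_dsum; apply: eq_bigr => la _.
  rewrite mxtrace_muln; congr (_ *+ _).
  have -> : \tr (outer_repr (specht R[i] mu 'I_b) (V la) g) =
      \tr (specht R[i] mu 'I_b g.1) * \tr (V la g.2) by apply: mxtrace_prod.
  by rewrite trV (trace_foulkes R[i] (hu la)).
split; first exact: trU.
move=> a2; subst a; apply: trU => la h.
have nb : (2 * b - b)%N = b by rewrite mul2n -addnn addnK.
by rewrite (trace_foulkes1 R[i] (hu la)).

Qed.
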